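(* Let $G$ be an $h$-edge-connected graph, and let $\theta$ be a real number with $0<\theta<1$. Suppose that $g$ and $f$ are integer-valued functions on $V(G)$ such that $g(v)\le \theta d_G(v)\le f(v)$ and $g(v)\equiv f(v)\pmod 2$ for all $v\in V(G)$, and $\sum_{v\in V(G)} f(v)$ is even. Let $\theta^*=\min\{\theta,1-\theta\}$, and let $h_e$ and $h_o$ be the even and the odd integer in $\{h,h+1\}$, respectively. If one of the following conditions (a)–(e) holds, then $G$ has a $(g,f)$-parity factor. (a) Either (i) $h\ge 1/\theta^*$, or (ii) $h<1/\theta^*\le \delta(G)$ and $\lambda_{\lceil 2/(1-\theta^* h)\rceil}(G)<\rho(\delta(G),\lceil 1/\theta^*\rceil-1)$. (b) $d_G(v)$ and $f(v)$ are even for all $v\in V(G)$. (c) $d_G(v)$ is even for all $v\in V(G)$, and either (i) $h_e\ge 1/\theta^*$, or (ii) $h_e<1/\theta^*\le\delta(G)$ and $\lambda_{\lceil 2/(1-\theta^* h_e)\rceil}(G)<\rho(\delta(G),\lceil 1/\theta^*\rceil-1)$. (d) $f(v)$ is even for all $v\in V(G)$, and either (i) $h_o\ge 1/(1-\theta)$, or (ii) $h_o<1/(1-\theta)\le\delta(G)$ and $\lambda_{\lceil 2/(1-(1-\theta)h_o)\rceil}(G)<\rho(\delta(G),\lceil 1/(1-\theta)\rceil-1)$. (e) $d_G(v)\equiv f(v)\pmod 2$ for all $v\in V(G)$, and either (i) $h_o\ge 1/\theta$, or (ii) $h_o<1/\theta\le\delta(G)$ and $\lambda_{\lceil 2/(1-\theta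 h_o)\rceil}(G)<\rho(\delta(G),\lceil 1/\theta\rceil-1)$.
   Context: Graphs are finite, without loops or multiple edges. $d_G(v)$ is the degree of $v$, $\delta(G)$ the minimum degree, and $\lambda_i(G)$ denotes the $i$-th largest eigenvalue of the adjacency matrix of $G$. For integer-valued functions $g\le f$ on $V(G)$ with $g(v)\equiv f(v)\pmod 2$ for all $v$, a $(g,f)$-parity factor of $G$ is a spanning subgraph $H$ such that for each $v\in V(G)$, $g(v)\le d_H(v)\le f(v)$ and $d_H(v)\equiv f(v)\pmod 2$. For positive integers $r>\eta$, define $\rho(r,\eta)=\frac12\big(r-2+\sqrt{(r+2)^2-8\lfloor \eta/2\rfloor}\big)$ if at least one of $r,\eta$ is even; $\rho(r,\eta)=\frac12\big(r-3+\sqrt{(r+3)^2-4\eta}\big)$ if both $r$ and $\eta$ are odd with $\eta\ge3$; and $\rho(r,1)=\mu$ if $r$ is odd, where $\mu$ is the largest real root of $x^3-(r-2)x^2-2rx+r-1=0$. *)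

(* Defs.v *)
From HB Require Import structures.
From mathcomp Require Export all_boot all_order all_algebra.
From mathcomp Require Export polyorder polyrcf.
From mathcomp Require Export reals.

Set Implicit Arguments.
Unset Strict Implicit.
Unset Printing Implicit Defensive.

Import Order.TTheory GRing.Theory Num.Theory.
Local Open Scope ring_scope.

Record sgraph (V : finType) := SGraph {
  adj :> rel V;
  adj_sym : symmetric adj;
  adj_irr : irreflexive adj
}.

Section Graphs.
Variable V : finType.
Implicit Types (G H : sgraph V) (v : V).

Definition deg G v : nat := #|[set w | G v w]|.

(* #|V| is a neutral element here, every degree being smaller than #|V|. *)
Definition min_deg G : nat := \big[minn/#|V|]_(v : V) deg G v.

Definition edges G : {set {set V}} :=
  [set [set p.1; p.2] | p : V * V & G p.1 p.2].

Definition del_edges G (F : {set {set V}}) : rel V :=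
  [rel x y | G x y && ([set x; y] \notin F)].

(* Every disconnecting set of edges has at least h elements; the one-vertex
   graph has no disconnecting set. *)
Definition edge_connected (h : nat) G : Prop :=
  forall F : {set {set V}}, F \subset edges G -> (#|F| < h)%N ->
    forall x y : V, connect (del_edges G F) x y.

Definition parity_factor G (g f : V -> int) H : Prop :=
  subrel H G /\
  forall v, g v <= (deg H v)%:Z <= f v /\ ((deg H v)%:Z = f v %[mod 2])%Z.

End Graphs.

Section Spectrum.
Variables (R : realType) (V : finType).
Implicit Types G : sgraph V.

Definition adjmx G : 'M[R]_#|V| :=
  \matrix_(i, j) (G (enum_val i) (enum_val j))%:R.

(* Real roots of the characteristic polynomial, repeated according to their
   multiplicities, in nonincreasing order. *)
Definition eigenvalues n (A : 'M[R]_n) : seq R :=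
  let p := char_poly A in
  sort >=%R (flatten [seq nseq (\mu_x p) x | x <- rootsR p]).

(* The index i starts at 1; the value is 0 when i > #|V|. *)
Definition lambda G (i : nat) : R := nth 0 (eigenvalues (adjmx G)) i.-1.

End Spectrum.

Section Rho.
Variable R : realType.

(* rootsR lists the real roots in increasing order. *)
Definition largest_root (p : {poly R}) : R := last 0 (rootsR p).

Definition rho (r eta : nat) : R :=
  if ~~ odd r || ~~ odd eta then
    (r%:R - 2 + Num.sqrt ((r%:R + 2) ^+ 2 - 8 * (eta %/ 2)%:R)) / 2
  else if (3 <= eta)%N then
    (r%:R - 3 + Num.sqrt ((r%:R + 3) ^+ 2 - 4 * eta%:R)) / 2
  else
    largest_root ('X^3 - (r%:R - 2) *: 'X^2 - (2 * r%:R) *: 'X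
                  + (r%:R - 1)%:P).

(* Only meant for x >= 0. *)
Definition ceiln (x : R) : nat := `|Num.ceil x|%N.

End Rho.

Definition even_of (h : nat) : nat := if odd h then h.+1 else h.
Definition odd_of (h : nat) : nat := if odd h then h else h.+1.

(* The alternative (i) or (ii) shared by the conditions of the theorem. *)
Definition spectral_cond (R : realType) (V : finType) (G : sgraph V)
    (t : R) (k : nat) : Prop :=
  1 / t <= k%:R \/
  [/\ k%:R < 1 / t, 1 / t <= (min_deg G)%:R
    & lambda R G (ceiln (2 / (1 - t * k%:R)))
        < rho R (min_deg G) (ceiln (1 / t) - 1)].

(* Main.v *)
Require Import Defs.
From mathcomp Require Import spectral sesquilinear complex zify ring lra.

Set Implicit Arguments.
Unset Strict Implicit.
Unset Printing Implicit Defensive.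

Import Order.TTheory GRing.Theory Num.Theory.
Local Open Scope ring_scope.

(* Among all spanning subgraphs H of G minimise the total deviation, the sum
   over v of the distance of deg H v to {g v, g v + 2, ..., f v}.  Toggling an
   edge changes the deviation of both ends by one, so an optimum N can be moved
   towards any other subgraph M one edge at a time: at a vertex deviating more
   in N than in M some edge of the symmetric difference improves that end, hence
   worsens the other one and keeps N optimal.  Vertices overloaded in some
   optimum and never short go to S, the opposite ones to T; there the deviation
   may be replaced by a linear penalty.  On a component of the remaining graph
   no two vertices deviate simultaneously, which gives Lovasz's bound: a minimal
   total deviation of at least 2 yields disjoint S and T with
     2 <= sum over odd components K of 1 - theta e(K,S) - (1 - theta) e(K,T).
   Under (a)-(e) each positive term is at most 1 - t k, hence there are at least
   2 / (1 - t k) components K sending fewer than 1 / t edges out.  Each of them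
   carries a vector with Rayleigh quotient at least rho; these vectors are
   orthogonal and not linked by edges, so the corresponding eigenvalue of G is at
   least rho as well. *)

(** * Eigenvalues and Rayleigh quotients *)

(** The threshold 2 is parity: the total deviation is congruent modulo 2 to the sum of [f], since
    degree sums are even. Vertices that are short in one optimum and overloaded in another cannot be
    linearised; for them an analogue of Gallai's lemma is used: never deviating together is
    transitive through such a vertex. In the final count the edges between [S] and [T] receive
    weights [theta] and [1 - theta] and cancel. A component joined to both sets has a nonpositive
    term, so in (d) and (e) the parity of a single number, e(K,T) or e(K,S), is enough. The values
    of [rho] are largest eigenvalues of explicit graphs: the complete graph on r + 1 vertices minus
    floor(eta/2) disjoint edges or, for r and eta odd, the complete graph on r + 2 vertices minus a
    2-regular graph on eta vertices and a perfect matching of the others. A 2-regular graph needs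
    three vertices; for eta = 1 a path on three vertices replaces it, and the cubic appears. In the
    first two graphs the Perron vector is affine in the codegree, which suggests the test vector for
    arbitrary components. *)

Lemma char_poly_similar (F : fieldType) n (P D : 'M[F]_n) :
  P \in unitmx -> char_poly (invmx P *m D *m P) = char_poly D.
Proof.
move=> uP; rewrite /char_poly.
have uP' : map_mx polyC P \in unitmx by rewrite map_unitmx.
have -> : char_poly_mx (invmx P *m D *m P)
  = invmx (map_mx polyC P) *m char_poly_mx D *m map_mx polyC P.
  rewrite /char_poly_mx mulmxBr mulmxBl !map_mxM map_invmx; congr (_ - _).
  by rewrite mul_mx_scalar -scalemxAl mulVmx // scalemx1.
rewrite !det_mulmx mulrC mulrA -det_mulmx mulmxV //.
by rewrite det1 mul1r.
Qed.

Lemma perm_eigenvalues (R : realType) n (A : 'M[R]_n) (d : 'I_n -> R) :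
  char_poly A = \prod_i ('X - (d i)%:P) ->
  perm_eq (eigenvalues A) [seq d i | i <- enum 'I_n].
Proof.
move=> Ap; rewrite /eigenvalues perm_sort; set p := char_poly A in Ap *.
have p0 : p != 0 by rewrite Ap prodf_seq_neq0; apply/allP => i _; rewrite polyXsubC_eq0.
have muE x : \mu_x p = count_mem x [seq d i | i <- enum 'I_n].
  have : \prod_(i <- enum 'I_n) ('X - (d i)%:P) != 0.
    by rewrite big_enum -Ap.
  rewrite Ap -[in LHS](big_enum _ _ _ (fun i => 'X - (d i)%:P)) /=.
  elim: (enum 'I_n) => [|i s IH]; first by rewrite big_nil mu_polyC.
  rewrite big_cons => nz; rewrite mu_mul // IH /=; last first.
    by apply: contraNneq nz => ->; rewrite mulr0.
  congr (_ + _)%N; have [->|ne] := eqVneq (d i) x; first by rewrite mu_XsubC.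
  by apply: muNroot; rewrite root_XsubC eq_sym.
apply/allP => x _ /=; rewrite -muE count_flatten -map_comp.
rewrite (eq_map (g := fun y => ((y == x) * \mu_y p)%N)); last first.
  by move=> y /=; rewrite count_nseq.
have us : uniq (rootsR p) by apply: uniq_roots.
have [xr|xr] := boolP (x \in rootsR p).
  rewrite sumnE big_map (bigD1_seq x) //= eqxx mul1n big1 ?addn0 // => y.
  by move=> /negPf ->.
rewrite (muNroot (x := x)); last first.
  by apply: contra xr => rx; rewrite -(roots_on_rootsR p0) inE.
rewrite sumnE big_map big1_seq // => y /andP[_ yr].
by case: eqP xr yr => [-> /negPf ->|].
Qed.

Lemma count_sorted_ge (R : realType) (s : seq R) (a : R) m :
  (m < size s)%N -> nth 0 (sort >=%R s) m < a -> (count (>= a) s <= m)%N.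
Proof.
set t := sort _ s; move=> ms tm.
have -> : count (>= a) s = count (>= a) t by apply/permP; rewrite perm_sym perm_sort.
rewrite -(cat_take_drop m t) count_cat.
have -> : count (>= a) (drop m t) = 0%N.
  apply/eqP; rewrite -leqn0 leqNgt -has_count; apply/hasPn => x xd.
  rewrite -ltNge; apply: le_lt_trans tm.
  have [i im <-] := nthP 0 xd.
  rewrite nth_drop.
  have st : sorted >=%R t by apply: sort_sorted => u v; exact: le_total.
  apply: (sorted_leq_nth (leT := >=%R) _ _ 0 st); rewrite ?inE ?size_sort //.
  - by move=> y x0 z /= h1 h2; apply: le_trans h2 h1.
  - by move=> x0 /=.
  - by rewrite size_drop size_sort in im; rewrite -ltn_subRL.
  - exact: leq_addr.
by rewrite addn0 (leq_trans (count_size _ _)) // size_take size_sort ms.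
Qed.

(** The diagonalisation is unitary over the complex numbers; hermitian symmetry makes the spectrum
    real, so the characteristic polynomial already splits over [R]. *)
Lemma real_sym_spectral (R : realType) n (A : 'M[R]_n) : A^T = A ->
  exists (P : 'M[R[i]]_n) (d : 'I_n -> R),
    [/\ P *m map_mx Num.conj P^T = 1%:M,
        char_poly A = \prod_i ('X - (d i)%:P)
      & map_mx (real_complex R) A
        = map_mx Num.conj P^T *m diag_mx (\row_i (d i)%:C%C) *m P].
Proof.
move=> sA; pose AC := map_mx (real_complex R) A.
have hA : AC \is hermsymmx.
  apply: realsym_hermsym.
    by apply/is_hermitianmxP; rewrite scale1r; apply/matrixP => i j; rewrite !mxE -{1}sA mxE.
  by apply/mxOverP => i j; rewrite mxE; apply/complex_realP; exists (A i j).
pose P := spectralmx AC; pose sp := spectral_diag AC.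
have uP : P \is unitarymx := spectral_unitarymx AC.
have eA : AC = invmx P *m diag_mx sp *m P.
  exact: (orthomx_spectralP (hermitian_normalmx hA)).
pose d i := complex.Re (sp 0 i).
have spE i : sp 0 i = (d i)%:C%C.
  by rewrite /d RRe_real //; apply: (mxOverP (hermitian_spectral_diag_real hA)).
have spr : sp = \row_i (d i)%:C%C by apply/rowP => i; rewrite mxE spE.
exists P, d; split.
- exact: (unitarymxP uP).
- apply: (map_poly_inj (real_complex R)); rewrite map_char_poly -/AC eA.
  rewrite char_poly_similar ?spectral_unit // char_poly_trig ?diag_mx_is_trig //.
  rewrite rmorph_prod /=; apply: eq_bigr => i _.
  by rewrite mxE eqxx mulr1n spE rmorphB /= map_polyX map_polyC.
- by rewrite -/AC eA spr invmx_unitary.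
Qed.

(* The easy half of the Courant-Fischer principle: a nonzero combination of
   the rows of Y that is orthogonal to every eigenvector of eigenvalue at
   least [a] has Rayleigh quotient both at least [a] and less than [a]. *)
Lemma eigenvalue_ge_of_orthogonal (R : realType) n m (A : 'M[R]_n)
    (Y : 'M[R]_(m, n)) (b c : 'rV[R]_m) (a : R) :
  A^T = A -> (0 < m <= n)%N ->
  Y *m Y^T = diag_mx b -> Y *m A *m Y^T = diag_mx c ->
  (forall i, 0 < b 0 i) -> (forall i, a * b 0 i <= c 0 i) ->
  a <= nth 0 (eigenvalues A) m.-1.
Proof.
move=> sA /andP[m0 mn] YY YAY b0 bc; rewrite leNgt; apply/negP => lt_a.
have [P [d [uP chA eA]]] := real_sym_spectral sA.
have pe := perm_eigenvalues chA.
have small : (#|[pred i | (a <= d i)%R]| < m)%N.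
  rewrite -[m]prednK // ltnS.
  have := @count_sorted_ge R (eigenvalues A) a m.-1.
  have -> : sort >=%R (eigenvalues A) = eigenvalues A.
    by apply: sorted_sort; [move=> y x z /= h1 h2; apply: le_trans h2 h1
                          | apply: sort_sorted => x y; exact: le_total].
  rewrite (perm_size pe) size_map -cardE card_ord prednK // => /(_ mn lt_a).
  rewrite (permP pe) count_map; congr (_ <= _)%N.
  by rewrite -size_filter cardE enumT; congr size; apply: eq_filter.
pose C := R[i].
pose toC := real_complex R.
pose YC := map_mx toC Y.
pose Q := map_mx Num.conj P^T.
have QP : Q *m P = 1%:M by apply: mulmx1C.
pose J := [pred i | a <= d i].
pose B : 'M[C]_(m, #|J|) := \matrix_(i, k) (YC *m Q) i (enum_val k).
(* [B] has [m] rows and fewer than [m] columns, so some nonzero [u] kills it; [z] below lists the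
   coordinates of [u Y] in the eigenbasis, and they vanish wherever [d j] is at least [a]. *)
have : kermx B != 0.
  by rewrite kermx_eq0 /row_free neq_ltn (leq_ltn_trans (rank_leq_col _)).
move=> /rowV0Pn [u /sub_kermxP uB u0].
pose z := u *m YC *m Q.
have zJ j : a <= d j -> z 0 j = 0.
  move=> aj; have jJ : j \in J by rewrite inE.
  suff -> : z 0 j = (u *m B) 0 (enum_rank_in jJ j) by rewrite uB mxE.
  rewrite /z -mulmxA [LHS]mxE [RHS]mxE; apply: eq_bigr => i _.
  by congr (_ * _); rewrite [in RHS]mxE enum_rankK_in.
pose us := map_mx Num.conj u^T; pose zs := map_mx Num.conj z^T.
have YCs : map_mx Num.conj YC^T = map_mx toC Y^T.
  by apply/matrixP => i j; rewrite !mxE; exact: conjc_real.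
have QS : map_mx Num.conj Q^T = P.
  by apply/matrixP => i j; rewrite !mxE conjCK.
have zsE : zs = P *m (map_mx toC Y^T *m us).
  by rewrite /zs /z trmx_mul map_mxM trmx_mul map_mxM YCs QS.
have diagE k (w : 'rV[C]_k) (e : 'I_k -> C) :
    (w *m diag_mx (\row_i e i) *m map_mx Num.conj w^T) 0 0 = \sum_i e i * `|w 0 i| ^+ 2.
  rewrite mxE; apply: eq_bigr => i _.
  rewrite !mxE (bigD1 i) //= !mxE eqxx big1 ?addr0 => [|j /negPf nj].
    by rewrite mulr1n normCK mulrAC mulrC.
  by rewrite mxE nj mulr0n mulr0.
have diagC (w : 'rV[R]_m) :
    map_mx toC (diag_mx w) = diag_mx (\row_i toC (w 0 i)).
  by apply/matrixP => i j; rewrite !mxE; case: eqP => _ //; rewrite mulr0n.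
have e1 : (z *m zs) 0 0 = \sum_i toC (b 0 i) * `|u 0 i| ^+ 2.
  have -> : z *m zs = u *m map_mx toC (Y *m Y^T) *m us.
    by rewrite zsE map_mxM -/YC /z !mulmxA -(mulmxA _ Q P) QP mulmx1.
  by rewrite YY diagC; exact: diagE.
have e2 : (z *m diag_mx (\row_i (d i)%:C%C) *m zs) 0 0
          = \sum_i toC (c 0 i) * `|u 0 i| ^+ 2.
  rewrite zsE /z.
  have -> : u *m YC *m Q *m diag_mx (\row_i (d i)%:C%C) *m
      (P *m (map_mx toC Y^T *m us)) = u *m map_mx toC (Y *m A *m Y^T) *m us.
    by rewrite !map_mxM eA -/Q -/YC !mulmxA.
  by rewrite YAY diagC; exact: diagE.
have le12 : toC a * (z *m zs) 0 0 <= (z *m diag_mx (\row_i (d i)%:C%C) *m zs) 0 0.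
  rewrite e1 e2 mulr_sumr; apply: ler_sum => i _.
  by rewrite mulrA -rmorphM /= ler_wpM2r ?exprn_ge0 // lecR.
have zz : (z *m zs) 0 0 = \sum_i `|z 0 i| ^+ 2.
  by rewrite mxE; apply: eq_bigr => i _; rewrite !mxE normCK.
have [j zj] : exists j, z 0 j != 0.
  apply/existsP; apply: contraNT u0; rewrite negb_exists => /forallP z0.
  have : (z *m zs) 0 0 = 0.
    by rewrite zz big1 // => i _; have := z0 i; rewrite negbK => /eqP->; rewrite normr0 expr0n.
  rewrite e1 => /psumr_eq0P h; apply/eqP/rowP => i; rewrite mxE.
  have : toC (b 0 i) * `|u 0 i| ^+ 2 = 0.
    apply: h => // k _; rewrite mulr_ge0 ?exprn_ge0 //.
    by rewrite ler0c; apply: ltW.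
  move/eqP; rewrite mulf_eq0 fmorph_eq0 (gt_eqF (b0 i)) /=.
  by rewrite sqrf_eq0 normr_eq0 => /eqP.
have : (z *m diag_mx (\row_i (d i)%:C%C) *m zs) 0 0 < toC a * (z *m zs) 0 0.
  rewrite diagE zz mulr_sumr (bigD1 j) //= [ltRHS](bigD1 j) //=.
  apply: ltr_leD.
    rewrite ltr_pM2r ?exprn_gt0 ?normr_gt0 // ltcR ltNge.
    by apply: contra zj => /zJ ->.
  apply: ler_sum => i _; have [/zJ ->|lt] := leP a (d i).
    by rewrite normr0 expr0n /= !mulr0.
  by rewrite ler_wpM2r ?exprn_ge0 // lecR ltW.
by move=> /(le_lt_trans le12); rewrite ltxx.
Qed.
Definition rayleigh_ge (R : realType) (V : finType) (G : rel V) (K : {set V})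
    (a : R) : Prop :=
  exists y : V -> R, 0 < \sum_(x in K) y x ^+ 2 /\
    a * (\sum_(x in K) y x ^+ 2)
      <= \sum_(x in K) \sum_(w in K) (G x w)%:R * y x * y w.

Lemma sum_enum_val (R : realType) (V : finType) (F : V -> R) :
  \sum_(i < #|V|) F (enum_val i) = \sum_x F x.
Proof.
rewrite [RHS](reindex (@enum_val V predT)) /=; last exact/onW_bij/enum_val_bij.
by [].
Qed.

(** The test vectors of [m] of the sets, extended by zero, are the rows of [Y]. Disjointness makes
    [Y Y^T] diagonal, the absence of edges between the sets makes [Y A Y^T] diagonal. *)
Lemma lambda_ge_of_rayleigh (R : realType) (V : finType) (G : sgraph V)
    (P : {set {set V}}) (m : nat) (a : R) :
  (0 < m <= #|P|)%N -> trivIset P ->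
  {in P &, forall K L : {set V}, K != L -> forall x w, x \in K -> w \in L -> ~~ G x w} ->
  {in P, forall K : {set V}, rayleigh_ge G K a} ->
  a <= lambda R G m.
Proof.
move=> /andP[m0 mP] tP nadj ray.
pose Ks (i : 'I_m) : {set V} := enum_val (widen_ord mP i).
have KsP i : Ks i \in P by apply: enum_valP.
have Kinj i j : i != j -> Ks i != Ks j.
  by apply: contraNneq => /enum_val_inj /(congr1 val) /= h; apply/eqP/val_inj.
have Kdis i j x : i != j -> x \in Ks i -> x \in Ks j -> False.
  move=> /Kinj nij xi xj; have := trivIsetP tP _ _ (KsP i) (KsP j) nij.
  by move/disjointFr => /(_ _ xi); rewrite xj.
have [y yP] := fin_all_exists (fun i => ray _ (KsP i)).
pose z i x := if x \in Ks i then y i x else 0.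
pose Y : 'M[R]_(m, #|V|) := \matrix_(i, k) z i (enum_val k).
pose b : 'rV[R]_m := \row_i \sum_(x in Ks i) y i x ^+ 2.
pose c : 'rV[R]_m :=
  \row_i \sum_(x in Ks i) \sum_(w in Ks i) (G x w)%:R * y i x * y i w.
have YY : Y *m Y^T = diag_mx b.
  apply/matrixP => i j; rewrite !mxE.
  under eq_bigr do rewrite !mxE.
  rewrite (sum_enum_val (fun x => z i x * z j x)) /z.
  have [<-|nij] := eqVneq i j; rewrite ?mulr1n ?mulr0n; last first.
    apply: big1 => x _; case: ifP => xi; rewrite ?mul0r //.
    by case: ifP => xj; rewrite ?mulr0 //; case: (Kdis i j x).
  rewrite [RHS]big_mkcond /=; apply: eq_bigr => x _.
  by case: ifP; rewrite ?mul0r // expr2.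
have YAY : Y *m adjmx R G *m Y^T = diag_mx c.
  apply/matrixP => i j.
  have -> : (Y *m adjmx R G *m Y^T) i j
      = \sum_x \sum_w (G x w)%:R * z i x * z j w.
    rewrite mxE; under eq_bigr => k _.
      rewrite mxE big_distrl /=.
      under eq_bigr => l _ do rewrite 3!mxE.
      over.
    rewrite exchange_big /= -(sum_enum_val (fun x => \sum_w (G x w)%:R * z i x * z j w)).
    apply: eq_bigr => l _; set x := enum_val l.
    rewrite -(sum_enum_val (fun w => (G x w)%:R * z i x * z j w)).
    by apply: eq_bigr => k _; rewrite mxE; congr (_ * _); rewrite mulrC.
  rewrite !mxE /z; have [<-|nij] := eqVneq i j; rewrite ?mulr1n ?mulr0n; last first.
    apply: big1 => x _; apply: big1 => w _.
    case: ifP => xi; last by rewrite mulr0 mul0r.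
    case: ifP => wj; last by rewrite mulr0.
    by rewrite (negPf (nadj _ _ (KsP i) (KsP j) (Kinj _ _ nij) _ _ xi wj)) !mul0r.
  rewrite [RHS]big_mkcond /=; apply: eq_bigr => x _; case: ifP => xi; last first.
    by apply: big1 => w _; rewrite mulr0 mul0r.
  by rewrite [RHS]big_mkcond /=; apply: eq_bigr => w _; case: ifP => wj; rewrite ?mulr0.
have b0 i : 0 < b 0 i by rewrite mxE; case: (yP i).
(* The default value 0 of [lambda] beyond [#|V|] is never met: a diagonal matrix with positive
   entries has rank [m]. *)
have mn : (m <= #|V|)%N.
  have : \rank (Y *m Y^T) = m.
    rewrite YY; apply: mxrank_unit; rewrite unitmxE det_diag unitfE.
    by rewrite prodf_seq_neq0; apply/allP => i _; rewrite gt_eqF.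
  by move=> <-; apply: leq_trans (mxrankM_maxl _ _) (rank_leq_col _).
apply: (eigenvalue_ge_of_orthogonal (A := adjmx R G) _ _ YY YAY b0).
- by apply/matrixP => i j; rewrite !mxE adj_sym.
- by rewrite m0.
- by move=> i; rewrite !mxE; case: (yP i).
Qed.

(** * Minimal total deviation *)

(* The distance from d to {g, g + 2, ..., f}. *)
Definition devz (g f d : int) : int :=
  if d < g then g - d else if f < d then d - f else (odd `|f - d|)%:Z.

Definition gap_even (g f : int) : bool := (g <= f) && ~~ odd `|f - g|.

(** With parities carried by the witness [k], this case split turns the later facts on [devz] into
    linear integer arithmetic. *)
Lemma devz_cases g f d : gap_even g f ->
  [\/ d < g /\ devz g f d = g - d, f < d /\ devz g f d = d - f,
      [/\ g <= d <= f, devz g f d = 0 & exists k, f = d + 2 * k]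
    | [/\ g < d < f, devz g f d = 1 & exists k, f = d + 2 * k + 1]].
Proof.
rewrite /devz => /andP[gf /negPf ev].
case: ltP => h1; first by constructor 1.
case: ltP => h2; first by constructor 2.
have dbl n : odd n = false -> n = (n./2 + n./2)%N.
  by move=> o; rewrite addnn -[LHS]odd_double_half o.
have dbl1 n : odd n -> n = (1 + (n./2 + n./2))%N.
  by move=> o; rewrite addnn -[LHS]odd_double_half o.
case: (boolP (odd _)) => [o|/negPf o].
  constructor 4; split=> //; last first.
    by exists (`|f - d|%N./2)%:Z; have := dbl1 _ o; lia.
  have := dbl1 _ o; have := dbl _ ev; lia.
constructor 3; split; [lia|by []|].
by exists (`|f - d|%N./2)%:Z; have := dbl _ o; lia.
Qed.

Lemma gap_evenE g f : gap_even g f -> exists k, f = g + 2 * k /\ 0 <= k.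
Proof.
move=> /andP[gf /negPf ev]; exists (`|f - g|%N./2)%:Z.
have : `|f - g|%N = (`|f - g|%N./2 + `|f - g|%N./2)%N.
  by rewrite addnn -[LHS]odd_double_half ev.
lia.
Qed.

Ltac devz_split ok d :=
  let h := fresh in
  have h := devz_cases d ok;
  case: h => [[? ?]|[? ?]|[? ? [? ?]]|[? ? [? ?]]].

Lemma devz_step g f d : gap_even g f ->
  devz g f (d + 1) = devz g f d + 1 \/ devz g f (d + 1) = devz g f d - 1.
Proof.
move=> ok; have [k [? ?]] := gap_evenE ok.
devz_split ok d; devz_split ok (d+1); lia.
Qed.

Lemma devz_ge0 g f d : gap_even g f -> 0 <= devz g f d.
Proof. move=> ok; devz_split ok d; lia. Qed.

(** [devz] falls with slope one up to [g], alternates between 0 and 1 up to [f], then rises with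
    slope one. So if some point to the right is strictly better, the first step to the right already
    gains one. *)
Lemma devz_incr g f d d' : gap_even g f -> devz g f d' < devz g f d -> d < d' ->
  devz g f (d + 1) = devz g f d - 1.
Proof.
move=> ok; have [k [? ?]] := gap_evenE ok.
devz_split ok d; devz_split ok (d+1); devz_split ok d'; lia.
Qed.

Lemma devz_decr g f d d' : gap_even g f -> devz g f d' < devz g f d -> d' < d ->
  devz g f (d - 1) = devz g f d - 1.
Proof.
move=> ok; have [k [? ?]] := gap_evenE ok.
devz_split ok d; devz_split ok (d-1); devz_split ok d'; lia.
Qed.

(** From a positive deviation only a step away from [g, f] can be a loss, since a point of wrong
    parity inside reaches deviation 0 on either side. *)
Lemma devz_worse g f d d' : gap_even g f -> d' = d + 1 \/ d' = d - 1 ->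
  devz g f d' = devz g f d + 1 -> 0 < devz g f d ->
  [/\ d < f -> d' < f, g < d -> g < d' & f < d -> f < d'].
Proof.
move=> ok; have [k [? ?]] := gap_evenE ok.
case=> ->.
  by devz_split ok d; devz_split ok (d+1) => h1 h2; split=> h3; lia.
by devz_split ok d; devz_split ok (d-1) => h1 h2; split=> h3; lia.
Qed.

Lemma devz_up g f d : gap_even g f -> 0 < devz g f d -> d < f ->
  devz g f (d + 1) = devz g f d - 1.
Proof.
move=> ok; have [k [? ?]] := gap_evenE ok.
devz_split ok d; devz_split ok (d+1); lia.
Qed.

Lemma devz_down g f d : gap_even g f -> 0 < devz g f d -> g < d ->
  devz g f (d - 1) = devz g f d - 1.
Proof.
move=> ok; have [k [? ?]] := gap_evenE ok.
devz_split ok d; devz_split ok (d-1); lia.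
Qed.

Lemma devz_ge_f g f d : gap_even g f -> 0 < devz g f d -> f <= d ->
  f < d /\ devz g f d = d - f.
Proof.
move=> ok; have [k [? ?]] := gap_evenE ok.
devz_split ok d; lia.
Qed.

Lemma devz_le_g g f d : gap_even g f -> 0 < devz g f d -> d <= g ->
  d < g /\ devz g f d = g - d.
Proof.
move=> ok; have [k [? ?]] := gap_evenE ok.
devz_split ok d; lia.
Qed.

Lemma devz_mid g f d : gap_even g f -> 0 < devz g f d -> g < d < f ->
  devz g f d = 1.
Proof.
move=> ok; have [k [? ?]] := gap_evenE ok.
devz_split ok d; lia.
Qed.

Lemma devz0_below g f d : gap_even g f -> devz g f d = 0 -> d < f -> d + 1 < f.
Proof.
move=> ok; have [k [? ?]] := gap_evenE ok.
devz_split ok d; lia.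
Qed.

Lemma gap_even_compl D g f : gap_even g f -> gap_even (D - f) (D - g).
Proof.
rewrite /gap_even lerD2l lerN2 => /andP[-> ev]; move: ev.
by have -> : D - g - (D - f) = f - g by ring.
Qed.

Lemma devz_compl D g f d : gap_even g f ->
  devz (D - f) (D - g) (D - d) = devz g f d.
Proof.
move=> ok; have ok' := gap_even_compl D ok; have [k [? ?]] := gap_evenE ok.
devz_split ok d; devz_split ok' (D - d); lia.
Qed.

Lemma devz00 (n : nat) : devz 0 0 n = n.
Proof. by rewrite /devz; case: n => [|n] //=; rewrite subr0. Qed.

Lemma devz_over g f d : gap_even g f -> f < d -> devz g f d = d - f.
Proof. by move=> /andP[gf _] fd; rewrite /devz fd ltNge (le_trans gf (ltW fd)). Qed.

Lemma sum_lt_exists (I : finType) (P : pred I) (a b : I -> int) :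
  \sum_(i | P i) a i < \sum_(i | P i) b i -> exists2 i, P i & a i < b i.
Proof.
move=> lt; apply/exists_inP; apply: contraTT lt => /exists_inPn h.
by rewrite -leNgt; apply: ler_sum => i Pi; rewrite leNgt; apply: h.
Qed.

(** * Optimal subgraphs under toggling of edges *)

Section Deviation.
Variables (V E : finType) (inc : E -> {set V}).
Hypothesis inc2 : forall e, #|inc e| = 2.
Implicit Types (H M N : {set E}) (e : E) (v x y : V).

Definition mdeg H v : nat := #|[set e in H | v \in inc e]|.

Definition toggle H e : {set E} := if e \in H then H :\ e else e |: H.

Definition dist N M : nat := #|[set e | (e \in N) != (e \in M)]|.

Lemma in_toggle H e e' : (e' \in toggle H e) = (e' \in H) (+) (e' == e).
Proof.
rewrite /toggle; case: ifP => eH; rewrite !inE; have [->|] := eqVneq e' e;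
by rewrite ?eH ?addbF ?addbT.
Qed.

Lemma distC N M : dist N M = dist M N.
Proof. by congr #|pred_of_set _|; apply/setP => e; rewrite !inE eq_sym. Qed.

Lemma toggle_dist N M e : (e \in N) != (e \in M) ->
  (dist (toggle N e) M < dist N M)%N.
Proof.
move=> d; apply: proper_card; apply/properP; split.
  apply/subsetP => e'; rewrite !inE in_toggle; have [->|_] := eqVneq e' e.
    by rewrite d.
  by rewrite addbF.
exists e; rewrite !inE ?d // in_toggle eqxx addbT.
by case: (e \in N) (e \in M) d => [] [].
Qed.

Lemma mdeg_toggle H e v : (mdeg (toggle H e) v)%:Z =
  (mdeg H v)%:Z + (if v \in inc e then if e \in H then -1 else 1 else 0).
Proof.
rewrite /mdeg; case: (boolP (v \in inc e)) => ve; last first.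
  rewrite addr0; congr (Posz #|pred_of_set _|); apply/setP => e'.
  rewrite !inE in_toggle; have [->|] := eqVneq e' e; last by rewrite addbF.
  by rewrite (negPf ve) !andbF.
rewrite /toggle; case: ifP => eH.
  have -> : [set e0 in H :\ e | v \in inc e0] = [set e0 in H | v \in inc e0] :\ e.
    by apply/setP => e'; rewrite !inE andbA.
  have := cardsD1 e [set e0 in H | v \in inc e0]; rewrite !inE eH ve /=; lia.
have -> : [set e0 in e |: H | v \in inc e0] = e |: [set e0 in H | v \in inc e0].
  apply/setP => e'; rewrite !inE; have [->|] := eqVneq e' e => //=.
by rewrite cardsU1 !inE eH /=; lia.
Qed.

Lemma eq_mdeg N N' v : (forall e, v \in inc e -> (e \in N) = (e \in N')) ->
  mdeg N v = mdeg N' v.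
Proof.
move=> h; rewrite /mdeg; congr #|pred_of_set _|; apply/setP => e; rewrite !inE.
by case: (boolP (v \in inc e)) => [/h ->|]; rewrite ?andbF.
Qed.

Lemma mdeg_lt_edge N M v : (mdeg N v < mdeg M v)%N ->
  exists e, [/\ v \in inc e, e \in M & e \notin N].
Proof.
move=> lt; have : ~~ ([set e in M | v \in inc e] \subset [set e in N | v \in inc e]).
  by apply: contraL lt => /subset_leq_card; rewrite -leqNgt.
case/subsetPn => e; rewrite !inE => /andP[eM ve]; rewrite ve andbT => eN.
by exists e.
Qed.

Lemma other_end e x : x \in inc e -> exists2 y, inc e = [set x; y] & x != y.
Proof.
move=> xe; have /cards2P [a [b [ab eE]]] := introT eqP (inc2 e).
move: xe; rewrite eE !inE => /orP[]/eqP ->; first by exists b.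
by exists a; rewrite 1?setUC 1?eq_sym.
Qed.

Section Cost.
Variables (g f : V -> int).
Hypothesis ok : forall v, gap_even (g v) (f v).

Definition dev H v : int := devz (g v) (f v) (mdeg H v).
Definition cost H : int := \sum_v dev H v.
Definition opt H : bool := [forall H' : {set E}, cost H <= cost H'].
Definition up H v : bool := (0 < dev H v) && ((mdeg H v)%:Z < f v).
Definition down H v : bool := (0 < dev H v) && (g v < (mdeg H v)%:Z).
(* Lovasz's class D.  A vertex inside (g, f) of the wrong parity is both up and
   down in the same subgraph. *)
Definition flexible v : bool :=
  [exists N : {set E}, opt N && down N v] && [exists N : {set E}, opt N && up N v].

Lemma dev_ge0 H v : 0 <= dev H v. Proof. exact: devz_ge0. Qed.

Lemma opt_cost N M : opt N -> opt M -> cost N = cost M.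
Proof.
move=> /forallP oN /forallP oM; apply/eqP.
by rewrite eq_le oN oM.
Qed.

Lemma opt_eq N M : opt N -> cost M = cost N -> opt M.
Proof. by move=> /forallP oN e; apply/forallP => H; rewrite e. Qed.

Lemma exists_opt : exists H, opt H.
Proof.
have [H _ h] := @arg_minP _ _ _ (set0 : {set E}) predT cost isT.
by exists H; apply/forallP => H'; apply: h.
Qed.

Lemma costD1 H v : cost H = dev H v + \sum_(x | x != v) dev H x.
Proof. by rewrite /cost (bigD1 v). Qed.

Lemma dev_toggle_out N e v : v \notin inc e -> dev (toggle N e) v = dev N v.
Proof. by move=> ve; rewrite /dev mdeg_toggle (negPf ve) addr0. Qed.

Lemma dev_toggle_in N e v : v \in inc e ->
  dev (toggle N e) v = dev N v + 1 \/ dev (toggle N e) v = dev N v - 1.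
Proof.
move=> ve; rewrite /dev mdeg_toggle ve; case: ifP => _; last exact: devz_step.
have := devz_step ((mdeg N v)%:Z - 1) (ok v); rewrite subrK; lia.
Qed.

Lemma cost_toggle N e x y : inc e = [set x; y] -> x != y ->
  cost (toggle N e) - cost N = (dev (toggle N e) x - dev N x)
                             + (dev (toggle N e) y - dev N y).
Proof.
move=> eE xy; rewrite /cost (bigD1 x) //= (bigD1 y) 1?eq_sym //=.
rewrite [X in _ - X](bigD1 x) //= [X in _ - (_ + X)](bigD1 y) 1?eq_sym //=.
have -> : \sum_(i | (i != x) && (i != y)) dev (toggle N e) i
        = \sum_(i | (i != x) && (i != y)) dev N i.
  by apply: eq_bigr => i /andP[ix iy]; rewrite dev_toggle_out // eE !inE negb_or ix.
ring.
Qed.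

(* An optimal subgraph stays optimal when a toggle improves one end: the other
   end must then get worse by exactly one. *)
Lemma opt_toggle N e x y : opt N -> inc e = [set x; y] -> x != y ->
  dev (toggle N e) x = dev N x - 1 ->
  opt (toggle N e) /\ dev (toggle N e) y = dev N y + 1.
Proof.
move=> oN eE xy dx; have h := cost_toggle N eE xy.
have le : cost N <= cost (toggle N e) by have /forallP := oN; apply.
have [dy|dy] : dev (toggle N e) y = dev N y + 1 \/ dev (toggle N e) y = dev N y - 1.
  by apply: dev_toggle_in; rewrite eE !inE eqxx orbT.
- split=> //; apply: opt_eq oN _; lia.
- lia.
Qed.

Lemma exchange N M x : opt N -> dev M x < dev N x ->
  exists e y, [/\ (e \in N) != (e \in M), inc e = [set x; y], x != y,
    opt (toggle N e) & dev (toggle N e) x = dev N x - 1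
                    /\ dev (toggle N e) y = dev N y + 1].
Proof.
move=> oN lt.
have [e [xe eNM dx]] : exists e, [/\ x \in inc e, (e \in N) != (e \in M)
    & dev (toggle N e) x = dev N x - 1].
  case: (ltngtP (mdeg N x) (mdeg M x)) => [l|l|eq].
  - have [e [xe eM eN]] := mdeg_lt_edge l; exists e; split=> //.
      by rewrite eM (negPf eN).
    rewrite /dev mdeg_toggle xe (negPf eN).
    by apply: devz_incr lt _ => //; rewrite ltz_nat.
  - have [e [xe eN eM]] := mdeg_lt_edge l; exists e; split=> //.
      by rewrite eN (negPf eM).
    rewrite /dev mdeg_toggle xe eN.
    by apply: devz_decr lt _ => //; rewrite ltz_nat.
  - by move: lt; rewrite /dev eq ltxx.
have [y eE xy] := other_end xe.
have [o dy] := opt_toggle oN eE xy dx.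
by exists e, y.
Qed.

(** If the exchanged edge ends at [v], it worsens [v], and by [devz_worse] a vertex that gets worse
    stays on its side of the interval; otherwise [v] is untouched. *)
Lemma exchange_off N M x v : opt N -> x != v -> dev M x < dev N x ->
  exists N', [/\ opt N', (dist N' M < dist N M)%N, dev N v <= dev N' v,
    down N v -> down N' v & (up N v -> up N' v) /\
    (f v < (mdeg N v)%:Z -> f v < (mdeg N' v)%:Z)].
Proof.
move=> oN xv lt; have [e [y [eNM eE xy o [dx dy]]]] := exchange oN lt.
exists (toggle N e); have lt_dist := toggle_dist eNM.
have [yv|yv] := eqVneq y v; last first.
  have ve : v \notin inc e by rewrite eE !inE negb_or 2!(eq_sym v) xv yv.
  by rewrite /down /up dev_toggle_out // mdeg_toggle (negPf ve) addr0; split.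
subst y; have step : (mdeg (toggle N e) v)%:Z = (mdeg N v)%:Z + 1 \/
    (mdeg (toggle N e) v)%:Z = (mdeg N v)%:Z - 1.
  by rewrite mdeg_toggle eE !inE eqxx orbT; case: ifP; [right|left].
have W := devz_worse (ok v) step dy.
have gt0 : f v < (mdeg N v)%:Z -> 0 < dev N v.
  by rewrite /dev; devz_split (ok v) (mdeg N v)%:Z; lia.
split=> //; first by rewrite dy lerDl.
- move=> /andP[d0 l]; have [_ w _] := W d0; apply/andP; split; last exact: w.
  by rewrite dy; apply: addr_gt0.
split=> [/andP[d0 l]|l].
  have [w _ _] := W d0; apply/andP; split; last exact: w.
  by rewrite dy; apply: addr_gt0.
by have [_ _ w] := W (gt0 l); apply: w.
Qed.

(** As long as exchanges avoid [v], equality of optimal costs preserves the excess away from [v], so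
    they can go on; the distance to [M] falls, so one of them finally hits [v]. Its edge [e] is the
    only change at [v]. *)
Lemma exchange_to N M v : opt N ->
  \sum_(x | x != v) dev M x < \sum_(x | x != v) dev N x ->
  exists N' e, [/\ opt N', (dist N' M < dist N M)%N, v \in inc e,
    forall e', v \in inc e' -> (e' \in N') = (e' \in toggle N e)
    & dev N' v = dev N v + 1].
Proof.
have [n] := ubnP (dist N M); elim: n N => // n IH N dn oN lt.
have [x xv ltx] := sum_lt_exists lt.
have [e [y [eNM eE xy o [dx dy]]]] := exchange oN ltx.
have dlt := toggle_dist eNM.
have [yv|yv] := eqVneq y v.
  subst y; exists (toggle N e), e; split=> //.
  by rewrite eE !inE eqxx orbT.
have ve : v \notin inc e by rewrite eE !inE negb_or 2!(eq_sym v) xv yv.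
have lt' : \sum_(x | x != v) dev M x < \sum_(x | x != v) dev (toggle N e) x.
  by have := opt_cost o oN; rewrite !(costD1 _ v) dev_toggle_out // => /addrI ->.
have [|N' [e' [oN' dN' ve' ag dv]]] := IH (toggle N e) _ o lt'.
  by rewrite ltnS in dn; apply: leq_trans dlt dn.
exists N', e'; split=> //; [exact: ltn_trans dlt| |by rewrite dv dev_toggle_out].
move=> e2 ve2; rewrite ag // !in_toggle; case: (eqVneq e2 e) ve2 => [->|_ _].
  by rewrite (negPf ve).
by rewrite addbF.
Qed.

Lemma dev_trichotomy N M v :
  [\/ exists2 x, x != v & dev M x < dev N x,
      exists2 x, x != v & dev N x < dev M x
    | \sum_(x | x != v) dev N x = \sum_(x | x != v) dev M x].
Proof.
case: (boolP [exists x in [pred x | x != v], dev M x < dev N x]) => [|/exists_inPn h1].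
  by case/exists_inP => x; rewrite inE => xv lt; constructor 1; exists x.
case: (boolP [exists x in [pred x | x != v], dev N x < dev M x]) => [|/exists_inPn h2].
  by case/exists_inP => x; rewrite inE => xv lt; constructor 2; exists x.
constructor 3; apply: eq_bigr => x xv; apply/eqP; rewrite eq_le !leNgt.
by rewrite h1 ?h2.
Qed.

Lemma opt_dev_eq N M v : opt N -> opt M ->
  \sum_(x | x != v) dev N x = \sum_(x | x != v) dev M x -> dev N v = dev M v.
Proof. by move=> oN oM e; have := opt_cost oN oM; rewrite !(costD1 _ v) e => /addIr. Qed.

Lemma down_or_up N v : 0 < dev N v -> down N v || up N v.
Proof.
move=> d0; rewrite /down /up d0 /=; have [//|le] := ltP (g v) _.
have [lt _] := devz_le_g (ok v) d0 le; apply: lt_le_trans lt _.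
by case/andP: (ok v).
Qed.

Lemma dev_toggle_down N v e : down N v -> v \in inc e -> e \in N ->
  dev (toggle N e) v = dev N v - 1.
Proof.
by move=> /andP[d0 gd] ve eN; rewrite /dev mdeg_toggle ve eN; apply: devz_down.
Qed.

Lemma dev_toggle_up N v e : up N v -> v \in inc e -> e \notin N ->
  dev (toggle N e) v = dev N v - 1.
Proof.
move=> /andP[d0 gd] ve /negPf eN; rewrite /dev mdeg_toggle ve eN.
exact: devz_up.
Qed.

Lemma down_notup N v : down N v -> ~~ up N v ->
  f v < (mdeg N v)%:Z /\ dev N v = (mdeg N v)%:Z - f v.
Proof.
by move=> /andP[d0 gd]; rewrite /up d0 /= -leNgt; apply: devz_ge_f.
Qed.

Lemma up_notdown N v : up N v -> ~~ down N v ->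
  (mdeg N v)%:Z < g v /\ dev N v = g v - (mdeg N v)%:Z.
Proof.
by move=> /andP[d0 gd]; rewrite /down d0 /= -leNgt; apply: devz_le_g.
Qed.

Lemma down_up_dev1 N v : down N v -> up N v -> dev N v = 1.
Proof.
by move=> /andP[d0 gd] /andP[_ df]; apply: devz_mid => //; rewrite gd.
Qed.

(* Induction on the distance between N and M, as in the next lemmas: every
   discrepancy away from v brings one of them closer to the other. *)
Lemma down_up_dev_le N M v : opt N -> opt M -> down N v -> up M v ->
  dev N v + dev M v <= 2.
Proof.
have [n] := ubnP (dist N M); elim: n N M => // n IH N M; rewrite ltnS => dn oN oM dN uM.
have [[x xv lt]|[x xv lt]|eq] := dev_trichotomy N M v.
- have [N' [oN' dN' le d' _]] := exchange_off oN xv lt.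
  by have := IH N' M (leq_trans dN' dn) oN' oM (d' dN) uM; lia.
- have [M' [oM' dM' le _ [u' _]]] := exchange_off oM xv lt.
  have dM2 : (dist N M' < n)%N.
    by apply: leq_trans dn; rewrite distC (distC N).
  by have := IH N M' dM2 oN oM' dN (u' uM); lia.
have eqd := opt_dev_eq oN oM eq.
(* Here the two deviations at [v] are equal, so a sum above 2 is at least 4: [N] lies above [f] and
   [M] below [g] at [v]. Deleting from [N] an edge outside [M] leaves a sum of at least 3, against
   the induction hypothesis. *)
case: (leP (dev N v + dev M v) 2) => // gt2.
have [oN2 eN2] : f v < (mdeg N v)%:Z /\ dev N v = (mdeg N v)%:Z - f v.
  apply: down_notup => //; apply/negP => uN; have := down_up_dev1 dN uN; lia.
have [oM2 _] : (mdeg M v)%:Z < g v /\ dev M v = g v - (mdeg M v)%:Z.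
  apply: up_notdown => //; apply/negP => dM; have := down_up_dev1 dM uM; lia.
have lt : (mdeg M v < mdeg N v)%N.
  have := ok v; rewrite /gap_even => /andP[gf _]; lia.
have [e [ve eN eM]] := mdeg_lt_edge lt.
have dv := dev_toggle_down dN ve eN.
have [y eE vy] := other_end ve.
have [oN' _] := opt_toggle oN eE vy dv.
have dN' : down (toggle N e) v.
  rewrite /down dv mdeg_toggle ve eN.
  have /andP[gf _] := ok v; move: gf gt2; rewrite -eqd eN2; clear.
  by move=> *; apply/andP; split; lia.
have dlt : (dist (toggle N e) M < n)%N.
  by apply: leq_trans dn; apply: toggle_dist; rewrite eN (negPf eM).
by have := IH _ _ dlt oN' oM dN' uM; rewrite dv; move: gt2 eqd; clear; lia.
Qed.

(** A deviating optimum is down or up at [v]; it is paired with an optimum of the opposite kind,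
    whose deviation is at least 1. *)
Lemma flexible_dev_le1 N v : flexible v -> opt N -> dev N v <= 1.
Proof.
case/andP => /existsP[N1 /andP[o1 d1]] /existsP[N2 /andP[o2 u2]] oN.
case: (leP (dev N v) 0) => [|d0]; first lia.
have := d1; have := u2; rewrite /down /up => /andP[? _] /andP[? _].
case/orP: (down_or_up d0) => h.
  by have := down_up_dev_le oN o2 h u2; lia.
by have := down_up_dev_le o1 oN d1 h; lia.
Qed.

(** Deleting [e] gains in an optimum that contains [e] and is down at [v]; adding it gains in one
    that misses [e] and is up. In the remaining case [e] lies outside [N] and inside [M], and the
    two are moved closer together. *)
Lemma flexible_improvable v e : flexible v -> v \in inc e ->
  exists N, [/\ opt N, 0 < dev N v & dev (toggle N e) v = dev N v - 1].
Proof.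
case/andP => /existsP[N /andP[oN dN]] /existsP[M /andP[oM uM]] ve.
have [n] := ubnP (dist N M); elim: n N M oN dN oM uM => // n IH N M oN dN oM uM.
rewrite ltnS => dn.
have dN0 := dN; have uM0 := uM; move: dN0 uM0 => /andP[dN0 _] /andP[dM0 _].
have [eN|eN] := boolP (e \in N).
  by exists N; split=> //; exact: dev_toggle_down.
have [eM|eM] := boolP (e \in M); last first.
  by exists M; split=> //; exact: dev_toggle_up.
have [uN|uN] := boolP (up N v).
  by exists N; split=> //; exact: dev_toggle_up.
have [dM|dM] := boolP (down M v).
  by exists M; split=> //; exact: dev_toggle_down.
have [[x xv lt]|[x xv lt]|eq] := dev_trichotomy N M v.
- have [N' [oN' dN' le d' _]] := exchange_off oN xv lt.
  exact: IH N' M oN' (d' dN) oM uM (leq_trans dN' dn).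
- have [M' [oM' dM' le _ [u' _]]] := exchange_off oM xv lt.
  have dM2 : (dist N M' < n)%N.
    by apply: leq_trans dn; rewrite distC (distC N).
  exact: IH N M' oN dN oM' (u' uM) dM2.
have [ovN eN2] := down_notup dN uN; have [ovM _] := up_notdown uM dM.
have gf : g v <= f v by case/andP: (ok v).
have lt : (mdeg M v < mdeg N v)%N by lia.
have [e2 [ve2 e2N e2M]] := mdeg_lt_edge lt.
have dv := dev_toggle_down dN ve2 e2N.
have [y e2E vy] := other_end ve2.
have [oN1 _] := opt_toggle oN e2E vy dv.
have dlt : (dist (toggle N e2) M < n)%N.
  by apply: leq_trans dn; apply: toggle_dist; rewrite e2N (negPf e2M).
set N1 := toggle N e2 in dv oN1 dlt.
have mN1 : (mdeg N1 v)%:Z = (mdeg N v)%:Z - 1 by rewrite mdeg_toggle ve2 e2N.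
have [d1|d1] := ltP 0 (dev N1 v).
  apply: (IH N1 M) => //; rewrite /down d1 mN1 /=.
  by move: d1 gf; rewrite dv eN2; clear; lia.
have dN1 : dev N1 v = 0 by apply/eqP; rewrite eq_le d1 dev_ge0.
(* The surplus has left [v]; exchanges towards [M] bring one unit back through an edge [e3]. Either
   [v] ends at [f v - 1], where adding [e] gains, or at [f v + 1], down again and closer to [M]. *)
have lt1 : \sum_(x | x != v) dev M x < \sum_(x | x != v) dev N1 x.
  have := opt_cost oN1 oM; rewrite !(costD1 _ v) dN1 add0r => ->.
  by rewrite ltrDr.
have [N' [e3 [oN' dN' ve3 ag dev']]] := exchange_to oN1 lt1.
have dl' : (dist N' M < n)%N by apply: ltn_trans dlt.
have mN' : mdeg N' v = mdeg (toggle N1 e3) v by apply: eq_mdeg.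
have dev0' : 0 < dev N' v by rewrite dev' dN1.
have mN'2 : (mdeg N' v)%:Z = (mdeg N1 v)%:Z + (if e3 \in N1 then -1 else 1).
  by rewrite mN' mdeg_toggle ve3.
have dNv : dev N v = 1 by apply/eqP; rewrite -subr_eq0 -dv dN1.
have mf : (mdeg N1 v)%:Z = f v by rewrite mN1 -dNv eN2 subKr.
case: (boolP (e3 \in N1)) mN'2 => [e3N1|e3N1] mN'2.
  exists N'; split=> //; apply: dev_toggle_up => //.
    by rewrite /up dev0' mN'2 mf /=; clear; lia.
  rewrite ag // in_toggle; have [->|ne] := eqVneq e e3; first by rewrite e3N1.
  rewrite addbF in_toggle (negPf eN) /=; apply: contraNneq eN => ->; exact: e2N.
apply: (IH N' M) => //; rewrite /down dev0' mN'2 mf /=.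
by move: gf; clear; lia.
Qed.

Lemma flexible_neighbour v w e : flexible v -> inc e = [set v; w] -> v != w ->
  exists2 N, opt N & 0 < dev N w.
Proof.
move=> dv eE vw; have ve : v \in inc e by rewrite eE !inE eqxx.
have [N [oN d0 dt]] := flexible_improvable dv ve.
have [o dw] := opt_toggle oN eE vw dt.
by exists (toggle N e) => //; rewrite dw; have := dev_ge0 N w; lia.
Qed.

(** In an optimum [M] where toggling [e] gains at [v], the vertex [u] cannot deviate: the toggle
    would bring it to 2. If both deviate in [N], exchanges of [M] towards [N] touch neither [v] nor
    [e], so they never stop although the distance falls. *)
Lemma flexible_adjacent u v e N : flexible u -> flexible v -> inc e = [set u; v] ->
  u != v -> opt N -> 0 < dev N u -> 0 < dev N v -> False.
Proof.
move=> du dv eE uv oN Nu Nv.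
have eE' : inc e = [set v; u] by rewrite eE setUC.
have vu : v != u by rewrite eq_sym.
have ve : v \in inc e by rewrite eE' !inE eqxx.
have factA M : opt M -> 0 < dev M u -> dev (toggle M e) v = dev M v - 1 -> False.
  move=> oM Mu dt; have [o dd] := opt_toggle oM eE' vu dt.
  by have := flexible_dev_le1 du o; lia.
have [M [oM Mv dt]] := flexible_improvable dv ve.
have [n] := ubnP (dist M N); elim: n M oM Mv dt => // n IH M oM Mv dt.
rewrite ltnS => dn.
have Mu : dev M u = 0.
  have [h|h] := ltP 0 (dev M u); last by have := dev_ge0 M u; lia.
  by case: (factA M).
have lt : \sum_(x | x != u) dev N x < \sum_(x | x != u) dev M x.
  have := opt_cost oM oN; rewrite !(costD1 _ u) Mu add0r => ->.
  by rewrite ltrDr.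
have [x xu ltx] := sum_lt_exists lt.
have v1 : dev N v = 1 by have := flexible_dev_le1 dv oN; lia.
have v2 : dev M v = 1 by have := flexible_dev_le1 dv oM; lia.
have xv : x != v by apply: contraTneq ltx => ->; rewrite v1 v2.
have [e' [y [eMN e'E xy o [dx dy]]]] := exchange oM ltx.
have yv : y != v.
  apply/eqP => yv; rewrite yv v2 in dy; have := flexible_dev_le1 dv o.
  by rewrite dy.
have ve' : v \notin inc e' by rewrite e'E !inE negb_or 2!(eq_sym v) xv yv.
have ee' : e == e' = false by apply: contraNF ve' => /eqP <-.
apply: (IH (toggle M e')) => //; first by rewrite dev_toggle_out.
  rewrite [dev (toggle M e') v]dev_toggle_out // -dt /dev; congr devz.
  by rewrite !mdeg_toggle ve (negPf ve') addr0 in_toggle ee' addbF.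
by apply: leq_trans dn; apply: toggle_dist.
Qed.

(** Let [u] and [v] deviate in [M], hence not [t], and let [t] deviate in [N], hence neither [u] nor
    [v]. Costs agree and [t] contributes only 1 in [N], so [N] has an excess elsewhere; exchanging
    it towards [M] keeps [t] deviating, and the distance falls for ever. *)
Lemma never_both_trans u t v : flexible t -> u != v ->
  (forall N, opt N -> 0 < dev N u -> 0 < dev N t -> False) ->
  (forall N, opt N -> 0 < dev N t -> 0 < dev N v -> False) ->
  forall N, opt N -> 0 < dev N u -> 0 < dev N v -> False.
Proof.
move=> dt uv ut tv M oM Mu Mv.
have zero N x : (0 < dev N x -> False) -> dev N x = 0.
  by move=> h; have := dev_ge0 N x; have [/h//|] := ltP 0 (dev N x); lia.
have Mt : dev M t = 0 by apply: zero; exact: ut.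
have tu : u != t by apply: contraTneq Mu => ->; rewrite Mt ltxx.
have tv' : v != t by apply: contraTneq Mv => ->; rewrite Mt ltxx.
case/andP: (dt) => /existsP[N /andP[oN /andP[Nt _]]] _.
have [n] := ubnP (dist N M); elim: n N oN Nt => // n IH N oN Nt; rewrite ltnS => dn.
have Nu : dev N u = 0 by apply: zero => h; exact: (ut N).
have Nv : dev N v = 0 by apply: zero; exact: (tv N).
have N1 : dev N t = 1 by have := flexible_dev_le1 dt oN; lia.
have [x xt ltx] : exists2 x, x != t & dev M x < dev N x.
  pose P x := [&& x != t, x != u & x != v].
  have split3 H : cost H = dev H t + (dev H u + (dev H v + \sum_(x | P x) dev H x)).
    rewrite (costD1 _ t) (bigD1 u) //= (bigD1 v) /=; last by rewrite tv' eq_sym.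
    by do 3 congr (_ + _); apply: eq_bigl => x; rewrite /P andbA.
  have : \sum_(x | P x) dev M x < \sum_(x | P x) dev N x.
    have := opt_cost oM oN; rewrite !split3 Mt Nu Nv N1.
    set a := \sum_(x | _) _; set b := \sum_(x | _) _; lia.
  by case/sum_lt_exists => x /and3P[xt _ _] lt; exists x.
have [N' [oN' dN' le _ _]] := exchange_off oN xt ltx.
by apply: (IH N') => //; [apply: lt_le_trans le|apply: leq_trans dn].
Qed.

End Cost.

(** * Linear penalties and the barrier *)

Definition upd (h : V -> int) s (c : int) v : int := if v == s then c else h v.

Section Saturated.
Variables (g f : V -> int) (s : V).
Hypothesis ok : forall v, gap_even (g v) (f v).
Hypothesis ge_f : forall N, opt g f N -> f s <= (mdeg N s)%:Z.

Let g' := upd g s 0.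
Let f' := upd f s 0.

Let ok' v : gap_even (g' v) (f' v).
Proof. by rewrite /g' /f' /upd; case: eqP. Qed.

Let dev'_off N x : x != s -> dev g' f' N x = dev g f N x.
Proof. by move=> /negPf xs; rewrite /dev /g' /f' /upd xs. Qed.

Let dev'_s N : dev g' f' N s = (mdeg N s)%:Z.
Proof.
by rewrite /dev /g' /f' /upd eqxx devz00.
Qed.

(* At a vertex s that is overloaded in some optimum and reaches f s in all of
   them, the deviation may be replaced by the linear penalty deg - f s. *)
Lemma saturated_cost M N : opt g f M -> f s < (mdeg M s)%:Z ->
  cost g f M + f s <= cost g' f' N.
Proof.
move=> oM fM; have [N0 oN0] := exists_opt g' f'.
apply: le_trans (forallP oN0 N); move: {N} N0 oN0 => N oN.
rewrite leNgt; apply/negP => lt.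
have [n] := ubnP (dist M N); elim: n M N oM fM oN lt => // n IH M N oM fM oN lt.
rewrite ltnS => dn.
have [[x xs ltx]|[x xs ltx]|eq] := dev_trichotomy g f M N s.
- have [M' [oM' dM' _ _ [_ fM']]] := exchange_off ok oM xs ltx.
  apply: (IH M' N) => //; [exact: fM'| |exact: leq_trans dn].
  by rewrite -(opt_cost oM oM').
- have ltx' : dev g' f' M x < dev g' f' N x by rewrite !dev'_off.
  have [N' [oN' dN' _ _ _]] := exchange_off ok' oN xs ltx'.
  apply: (IH M N') => //; first by rewrite -(opt_cost oN oN').
  by apply: leq_trans dn; rewrite distC (distC M).
have devM : dev g f M s = (mdeg M s)%:Z - f s by exact: devz_over.
have eq' : \sum_(x | x != s) dev g' f' N x = \sum_(x | x != s) dev g f N x.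
  by apply: eq_bigr => x /dev'_off.
have costN : cost g' f' N = (mdeg N s)%:Z + \sum_(x | x != s) dev g f N x.
  by rewrite (costD1 _ _ _ s) dev'_s eq'.
have costM : cost g f M = (mdeg M s)%:Z - f s + \sum_(x | x != s) dev g f N x.
  by rewrite (costD1 _ _ _ s) devM eq.
have ltm : (mdeg N s < mdeg M s)%N.
  move: lt; rewrite costN costM; move: (\sum_(x | _) _); clear; lia.
have [e [se eM eN]] := mdeg_lt_edge ltm.
have dM : down g f M s.
  rewrite /down devM subr_gt0 fM; apply: le_lt_trans fM; by case/andP: (ok s).
have dv := dev_toggle_down ok dM se eM.
have [y eE sy] := other_end se.
have [oM1 _] := opt_toggle ok oM eE sy dv.
have dlt : (dist (toggle M e) N < n)%N.
  by apply: leq_trans dn; apply: toggle_dist; rewrite eM (negPf eN).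
have mM1 : (mdeg (toggle M e) s)%:Z = (mdeg M s)%:Z - 1 by rewrite mdeg_toggle se eM.
have cM1 := opt_cost oM oM1.
move: (toggle M e) dv oM1 dlt mM1 cM1 => M1 dv oM1 dlt mM1 cM1.
have [fM1|fM1] := ltP (f s) (mdeg M1 s)%:Z.
  by apply: (IH M1 N) => //; rewrite -cM1.
have mM1' : (mdeg M1 s)%:Z = f s by apply/eqP; rewrite eq_le fM1 ge_f.
have dM1 : dev g f M1 s = 0.
  by rewrite dv devM; move: mM1 mM1'; clear; lia.
(* [M1] meets [f s] exactly, so the excess over [N] lies elsewhere. Brought back to [s], it cannot
   lower the degree below [f s], by [ge_f]; so [M'] is overloaded at [s] again and closer to [N]. *)
have lt1 : \sum_(x | x != s) dev g f N x < \sum_(x | x != s) dev g f M1 x.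
  move: cM1; rewrite costM (costD1 _ _ M1 s) dM1 add0r => <-.
  by rewrite ltrDr subr_gt0.
have [M' [e3 [oM' dM' se3 ag dev']]] := exchange_to ok oM1 lt1.
have mM' : (mdeg M' s)%:Z = f s + (if e3 \in M1 then -1 else 1).
  by rewrite (eq_mdeg ag) mdeg_toggle se3 mM1'.
apply: (IH M' N) => //; last exact: ltn_trans dlt.
  have := ge_f oM'; rewrite mM'; case: ifP => _; clear; lia.
by rewrite -(opt_cost oM oM').
Qed.

End Saturated.

Lemma down_only_cost g f s M N : (forall v, gap_even (g v) (f v)) ->
  opt g f M -> down g f M s -> (forall L, opt g f L -> ~~ up g f L s) ->
  cost g f M + f s <= cost (upd g s 0) (upd f s 0) N.
Proof.
move=> ok oM dM nup; apply: saturated_cost => //; last first.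
  by have [] := down_notup ok dM (nup _ oM).
move=> L oL; rewrite leNgt; apply/negP => lt.
(* An optimum below [f s] has deviation 0 at [s], as it is not up, hence degree at most [f s - 2] by
   parity. Returning one unit to [s] gives degree at most [f s - 1] and deviation 1, which is up. *)
have dL : dev g f L s = 0.
  have := nup _ oL; rewrite /up lt andbT -leNgt => le.
  by apply/eqP; rewrite eq_le le dev_ge0.
have ltS : \sum_(x | x != s) dev g f M x < \sum_(x | x != s) dev g f L x.
  have := opt_cost oL oM; rewrite !(costD1 _ _ _ s) dL add0r => ->.
  by rewrite ltrDr; case/andP: dM.
have [L' [e [oL' _ se ag dev']]] := exchange_to ok oL ltS.
have := nup _ oL'; rewrite /up dev' dL add0r ltr01 /= (eq_mdeg ag) mdeg_toggle se.
have := devz0_below (ok s) dL lt; case: ifP => _; clear; lia.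
Qed.

Definition fdeg v : nat := mdeg [set: E] v.

Lemma mdeg_compl H v : (mdeg (~: H) v)%:Z = (fdeg v)%:Z - (mdeg H v)%:Z.
Proof.
rewrite /fdeg /mdeg.
have := cardsID H [set e in [set: E] | v \in inc e].
have -> : [set e in [set: E] | v \in inc e] :&: H = [set e in H | v \in inc e].
  by apply/setP => e; rewrite !inE andbC.
have -> : [set e in [set: E] | v \in inc e] :\: H = [set e in ~: H | v \in inc e].
  by apply/setP => e; rewrite !inE.
by clear; lia.
Qed.

(** Passing to the complement of [H] in [G] turns the bounds [(g, f)] into [(cobound f, cobound g)],
    keeps deviations and swaps [up] with [down]; the statement for [T] thus follows from that for
    [S]. *)
Definition cobound (h : V -> int) v : int := (fdeg v)%:Z - h v.

Section Complement.
Variables (g f : V -> int).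
Hypothesis ok : forall v, gap_even (g v) (f v).

Lemma dev_compl H v : dev (cobound f) (cobound g) (~: H) v = dev g f H v.
Proof. by rewrite /dev /cobound mdeg_compl devz_compl. Qed.

Lemma cost_compl H : cost (cobound f) (cobound g) (~: H) = cost g f H.
Proof. by apply: eq_bigr => v _; exact: dev_compl. Qed.

Lemma opt_compl H : opt (cobound f) (cobound g) (~: H) = opt g f H.
Proof.
apply/forallP/forallP => h N; first by rewrite -!cost_compl.
by rewrite -(setCK N) !cost_compl.
Qed.

Lemma down_compl H v : down (cobound f) (cobound g) (~: H) v = up g f H v.
Proof.
rewrite /down /up dev_compl; congr (_ && _); rewrite /cobound mdeg_compl.
by rewrite ltrD2l ltrN2.
Qed.

Lemma up_compl H v : up (cobound f) (cobound g) (~: H) v = down g f H v.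
Proof.
rewrite /down /up dev_compl; congr (_ && _); rewrite /cobound mdeg_compl.
by rewrite ltrD2l ltrN2.
Qed.

End Complement.

Lemma upd_ok g f s c : (forall v, gap_even (g v) (f v)) ->
  forall v, gap_even (upd g s c v) (upd f s c v).
Proof.
by move=> ok v; rewrite /upd; case: eqP => // _; rewrite /gap_even lexx subrr.
Qed.

Lemma up_only_cost g f t M N : (forall v, gap_even (g v) (f v)) ->
  opt g f M -> up g f M t -> (forall L, opt g f L -> ~~ down g f L t) ->
  cost g f M + ((fdeg t)%:Z - g t)
    <= cost (upd g t (fdeg t)) (upd f t (fdeg t)) N.
Proof.
move=> ok oM uM ndown.
have ok' v : gap_even (cobound f v) (cobound g v) by apply: gap_even_compl.
have := @down_only_cost (cobound f) (cobound g) t (~: M) (~: N) ok'.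
rewrite opt_compl // down_compl // cost_compl // => /(_ oM uM).
have -> : cost (upd (cobound f) t 0) (upd (cobound g) t 0) (~: N)
    = cost (upd g t (fdeg t)) (upd f t (fdeg t)) N.
  rewrite -[RHS]cost_compl; last exact: upd_ok.
  apply: eq_bigr => v _; rewrite /dev /cobound /upd.
  by case: eqP => [->|//]; rewrite subrr.
apply=> L; rewrite -(setCK L) opt_compl // up_compl //; exact: ndown.
Qed.

Section Barrier.
Variables (g f : V -> int).
Hypothesis ok : forall v, gap_even (g v) (f v).

(* The bounds (0, 0) on S and (deg, deg) on T turn the deviation into the linear
   penalties deg H and deg G - deg H. *)
Definition lift_bound (S T : {set V}) (h : V -> int) v : int :=
  if v \in S then 0 else if v \in T then (fdeg v)%:Z else h v.

Notation gST S T := (lift_bound S T g).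
Notation fST S T := (lift_bound S T f).

Lemma lift_ok (S T : {set V}) v : gap_even (gST S T v) (fST S T v).
Proof.
rewrite /lift_bound; case: ifP => _; first by rewrite /gap_even lexx subrr.
by case: ifP => _ //; rewrite /gap_even lexx subrr.
Qed.

Lemma lift_upd0 (S T : {set V}) h v x :
  lift_bound (v |: S) T h x = upd (lift_bound S T h) v 0 x.
Proof. by rewrite /lift_bound /upd !inE; case: eqP. Qed.

Lemma lift_updT (S T : {set V}) h v x : v \notin S ->
  lift_bound S (v |: T) h x = upd (lift_bound S T h) v (fdeg v) x.
Proof.
move=> vS; rewrite /lift_bound /upd !inE.
by case: eqP => [->|//]; rewrite (negPf vS).
Qed.

Lemma eq_cost g1 g2 f1 f2 N : g1 =1 g2 -> f1 =1 f2 ->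
  cost g1 f1 N = cost g2 f2 N.
Proof. by move=> eg ef; apply: eq_bigr => v _; rewrite /dev eg ef. Qed.

(** Vertices join one at a time, and flexibility always refers to the bounds modified so far. A
    deviating vertex that is not flexible is down in no optimum or up in no optimum, so it can join
    [T] or [S] with the corresponding cost bound. *)
Lemma exists_barrier : exists S T : {set V}, [/\ [disjoint S & T],
  forall M N, opt g f M -> opt (gST S T) (fST S T) N ->
    cost g f M + \sum_(v in S) f v + \sum_(v in T) ((fdeg v)%:Z - g v)
      <= cost (gST S T) (fST S T) N
  & forall v L, v \notin S :|: T -> opt (gST S T) (fST S T) L ->
    0 < dev (gST S T) (fST S T) L v -> flexible (gST S T) (fST S T) v].
Proof.
suff H n (S T : {set V}) : (#|~: (S :|: T)| < n)%N -> [disjoint S & T] ->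
  (forall M N, opt g f M -> opt (gST S T) (fST S T) N ->
    cost g f M + \sum_(v in S) f v + \sum_(v in T) ((fdeg v)%:Z - g v)
      <= cost (gST S T) (fST S T) N) ->
  exists S T : {set V}, [/\ [disjoint S & T],
  forall M N, opt g f M -> opt (gST S T) (fST S T) N ->
    cost g f M + \sum_(v in S) f v + \sum_(v in T) ((fdeg v)%:Z - g v)
      <= cost (gST S T) (fST S T) N
  & forall v L, v \notin S :|: T -> opt (gST S T) (fST S T) L ->
    0 < dev (gST S T) (fST S T) L v -> flexible (gST S T) (fST S T) v].
  apply: (H _ set0 set0 (ltnSn _)); first by rewrite disjoints_subset sub0set.
  move=> M N oM oN; rewrite !big_set0 !addr0.
  rewrite (eq_cost (g2 := g) (f2 := f)) => [|v|v]; rewrite /lift_bound ?inE //.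
  exact: (forallP oM).
elim: n S T => // n IH S T; rewrite ltnS => card dis inv.
case: (boolP [forall v, forall L : {set E}, (v \notin S :|: T) ==>
   opt (gST S T) (fST S T) L ==> (0 < dev (gST S T) (fST S T) L v) ==>
   flexible (gST S T) (fST S T) v]) => [/forallP h|].
  exists S, T; split=> // v L vST oL dL.
  by have /forallP/(_ L)/implyP/(_ vST)/implyP/(_ oL)/implyP/(_ dL) := h v.
case/forallPn => v /forallPn [L]; rewrite !negb_imply.
case/and4P => vST oL dL ndt.
have [vS vT] : v \notin S /\ v \notin T by move: vST; rewrite inE negb_or => /andP.
have okST := lift_ok S T.
have smaller (S' T' : {set V}) : S' :|: T' = v |: (S :|: T) -> (#|~: (S' :|: T')| < n)%N.
  move=> ->; apply: leq_trans card; rewrite setCU.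
  apply: proper_card; apply/properP; split; first exact: subsetIr.
  by exists v; rewrite !inE ?eqxx // -in_setU.
have gv : gST S T v = g v by rewrite /lift_bound (negPf vS) (negPf vT).
have fv : fST S T v = f v by rewrite /lift_bound (negPf vS) (negPf vT).
move: ndt; rewrite /flexible.
case: (boolP [exists N : {set E}, _ && down _ _ N v]) => /= [/existsP[M0 /andP[oM0 dM0]]|ndown]; last first.
  have uL : up (gST S T) (fST S T) L v.
    case/orP: (down_or_up okST dL) => // dL'.
    by case/negP: ndown; apply/existsP; exists L; rewrite oL.
  move=> _; apply: (IH S (v |: T)); first by apply: smaller; rewrite setUCA.
    rewrite disjoint_sym disjoints_subset subUset sub1set inE vS -disjoints_subset.
    by rewrite disjoint_sym.
  move=> M N oM oN; rewrite (big_setU1 _ vT) /=.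
  have nd K : opt (gST S T) (fST S T) K -> ~~ down (gST S T) (fST S T) K v.
    by move=> oK; apply: contra ndown => dK; apply/existsP; exists K; rewrite oK.
  have := up_only_cost N okST oL uL nd; rewrite gv.
  rewrite -(eq_cost _ (fun x => lift_updT T g x vS) (fun x => lift_updT T f x vS)).
  apply: le_trans; have := inv M L oM oL.
  set a := cost _ _ M; set b := \sum_(i in S) _; set c := \sum_(i in T) _.
  set d := cost _ _ L; move: a b c d (fdeg v)%:Z (g v); clear; lia.
move=> nup; apply: (IH (v |: S) T); first by apply: smaller; rewrite setUA.
  by rewrite disjoints_subset subUset sub1set inE vT -disjoints_subset.
move=> M N oM oN; rewrite (big_setU1 _ vS) /=.
have nu K : opt (gST S T) (fST S T) K -> ~~ up (gST S T) (fST S T) K v.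
  by move=> oK; apply: contra nup => dK; apply/existsP; exists K; rewrite oK.
have := down_only_cost N okST oM0 dM0 nu; rewrite fv.
rewrite -(eq_cost _ (lift_upd0 S T g v) (lift_upd0 S T f v)).
apply: le_trans; have := inv M M0 oM oM0.
set a := cost _ _ M; set b := \sum_(i in S) _; set c := \sum_(i in T) _.
set d := cost _ _ M0; move: a b c d (f v); clear; lia.
Qed.

End Barrier.
End Deviation.

(** * Barriers and odd components *)

Section BarrierEdges.
Variables (V E : finType) (inc : E -> {set V}).
Hypothesis inc2 : forall e, #|inc e| = 2.
Variables (g f : V -> int) (S T : {set V}).
Hypothesis ok : forall v, gap_even (g v) (f v).
Hypothesis dis : [disjoint S & T].

Let gST := lift_bound inc S T g.
Let fST := lift_bound inc S T f.
Let okST v : gap_even (gST v) (fST v). Proof. exact: lift_ok. Qed.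

Lemma dev_lift_S N v : v \in S -> dev inc gST fST N v = (mdeg inc N v)%:Z.
Proof. by move=> vS; rewrite /dev /gST /fST /lift_bound vS devz00. Qed.

Lemma dev_lift_T N v : v \in T ->
  dev inc gST fST N v = (fdeg inc v)%:Z - (mdeg inc N v)%:Z.
Proof.
move=> vT; have /negPf vS : v \notin S by apply: contraL vT => /(disjointFr dis) ->.
rewrite /dev /gST /fST /lift_bound vS vT /devz.
have le : (mdeg inc N v <= fdeg inc v)%N.
  apply: subset_leq_card; apply/subsetP => e; rewrite !inE; by case/andP.
move: le; rewrite leq_eqVlt => /orP[/eqP ->|lt]; first by rewrite ltxx subrr.
by rewrite ltz_nat lt.
Qed.

Lemma dev_lift_W N v : v \notin S :|: T ->
  dev inc gST fST N v = dev inc g f N v.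
Proof.
by rewrite inE negb_or => /andP[/negPf vS /negPf vT]; rewrite /dev /gST /fST /lift_bound vS vT.
Qed.

Definition misplaced (N : {set E}) : {set E} :=
  [set e | if e \in N then ~~ [disjoint inc e & S] && [disjoint inc e & T]
           else ~~ [disjoint inc e & T] && [disjoint inc e & S]].

(** Toggling a misplaced edge lowers a linear penalty at its end in [S] or [T], so optimality
    survives, and the edge is no longer misplaced. *)
Lemma exists_placed_opt : exists2 N, opt inc gST fST N & misplaced N = set0.
Proof.
have [N oN] := exists_opt inc gST fST.
have [n] := ubnP #|misplaced N|; elim: n N oN => // n IH N oN; rewrite ltnS => card.
have [e0|[e eB]] := set_0Vmem (misplaced N); first by exists N.
have [x [xe dx]] : exists x, x \in inc e /\
    dev inc gST fST (toggle N e) x = dev inc gST fST N x - 1.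
  move: (eB); rewrite inE; case: ifP => eN /andP[/pred0Pn[x /andP[/= xe xA]] _];
    exists x; split=> //.
    by rewrite !dev_lift_S // mdeg_toggle xe eN.
  by rewrite !dev_lift_T // mdeg_toggle xe eN opprD addrA.
have [y eE xy] := other_end inc2 xe.
have [o _] := opt_toggle okST oN eE xy dx.
apply: (IH _ o); apply: leq_trans card; apply: proper_card; apply/properP; split.
  apply/subsetP => e'; rewrite !inE in_toggle; have [->|_] := eqVneq e' e; last by rewrite addbF.
  move: eB; rewrite inE addbT; case: (e \in N) => /= /andP[_ h] /andP[h' _];
  by rewrite h in h'.
exists e => //; move: eB; rewrite !inE in_toggle eqxx addbT.
by case: (e \in N) => /= /andP[/negPf h1 h2]; rewrite h1 h2.
Qed.

Lemma placedP N e x y : misplaced N = set0 -> inc e = [set x; y] ->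
  (x \in S -> y \notin T -> e \notin N) /\ (x \in T -> y \notin S -> e \in N).
Proof.
move=> /setP/(_ e); rewrite !inE => h eE.
have dE (A : {set V}) : [disjoint inc e & A] = (x \notin A) && (y \notin A).
  by rewrite disjoints_subset eE subUset !sub1set !inE.
move: h; rewrite !dE; split=> [xS yT|xT yS].
  have xT : x \notin T by apply: contraL xS => /(disjointFl dis) ->.
  by apply/negP => eN; move: h; rewrite eN xS xT yT.
have xS : x \notin S by apply: contraL xT => /(disjointFr dis) ->.
by apply: contraFT h => /negPf ->; rewrite xT xS yS.
Qed.

(** Along a path from [u], flexibility spreads because a gain at one end of an edge is a deviation
    at the other; not deviating together with [u] spreads by [never_both_trans]. *)
Lemma component_dev_le1 N (r : rel V) u v :
  (forall v L, v \notin S :|: T -> opt inc gST fST L ->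
     0 < dev inc gST fST L v -> flexible inc gST fST v) ->
  (forall x y, r x y -> [/\ x \notin S :|: T, y \notin S :|: T, x != y
     & exists e, inc e = [set x; y]]) ->
  opt inc gST fST N -> connect r u v -> u \notin S :|: T -> u != v ->
  0 < dev inc gST fST N u -> 0 < dev inc gST fST N v -> False.
Proof.
move=> hD hr oN cuv uW uv du; have dtu := hD _ _ uW oN du.
suff [_] : flexible inc gST fST v /\ (v != u -> forall L, opt inc gST fST L ->
    0 < dev inc gST fST L u -> 0 < dev inc gST fST L v -> False).
  by move=> /(_ _ N oN du); apply; rewrite eq_sym.
case/connectP: cuv => p; elim/last_ind: p v {uv} => [|p w IH] v /=.
  by move=> _ ->; split=> //; rewrite eqxx.
rewrite rcons_path last_rcons => /andP[pp rw] ->.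
have [dl nl] := IH _ pp erefl; move: dl nl; set t := last u p in rw *.
move=> dt nt; have [tW wW tw [e eE]] := hr _ _ rw.
have dw : flexible inc gST fST w.
  by have [L oL dL] := flexible_neighbour inc2 okST dt eE tw; apply: hD oL dL.
have adj := flexible_adjacent inc2 okST dt dw eE tw.
split=> // wu; have [tu|tu] := eqVneq t u.
  by move=> L oL Lu Lw; apply: (adj L oL) => //; rewrite tu.
have uw : u != w by rewrite eq_sym.
exact: (never_both_trans inc2 okST dt uw (nt tu)).
Qed.

End BarrierEdges.

(** * Edge counts and components of induced subgraphs *)

Section Counting.
Variable V : finType.
Implicit Types (h : rel V) (A B K : {set V}).

(** Ordered pairs are counted: for a graph, [ecount h K K] is twice the number of edges inside
    [K]. *)
Definition ecount h A B : nat := (\sum_(x in A) \sum_(y in B) h x y)%N.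

Lemma ecountC h A B : symmetric h -> ecount h A B = ecount h B A.
Proof.
move=> hs; rewrite /ecount exchange_big /=; apply: eq_bigr => x _.
by apply: eq_bigr => y _; rewrite hs.
Qed.

Lemma ecountUr h K A B : [disjoint A & B] ->
  ecount h K (A :|: B) = (ecount h K A + ecount h K B)%N.
Proof.
move=> dAB; rewrite /ecount -big_split /=; apply: eq_bigr => x _.
by rewrite -bigU //=; apply: eq_bigl => y; rewrite inE.
Qed.

Lemma ecount0 h A B : {in A & B, forall x y, ~~ h x y} -> ecount h A B = 0%N.
Proof.
by move=> h0; rewrite /ecount big1 // => x xA; rewrite big1 // => y yB; rewrite (negPf (h0 _ _ xA yB)).
Qed.

Lemma handshake h K : symmetric h -> irreflexive h -> ~~ odd (ecount h K K).
Proof.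
move=> hs hi; have [n] := ubnP #|K|; elim: n K => // n IH K; rewrite ltnS => card.
have [->|[x xK]] := set_0Vmem K; first by rewrite /ecount big_set0.
have cD : (#|K :\ x| < n)%N by apply: leq_trans card; rewrite (cardsD1 x K) xK.
have -> : ecount h K K = (ecount h (K :\ x) (K :\ x) + (ecount h [set x] (K :\ x)).*2)%N.
  have split2 A : ecount h A K = (ecount h A [set x] + ecount h A (K :\ x))%N.
    rewrite -ecountUr ?setD1K //.
    by rewrite disjoints_subset sub1set !inE eqxx.
  rewrite split2 [ecount h K [set x]]ecountC // split2.
  rewrite [ecount h K (K :\ x)]ecountC // split2 [ecount h (K :\ x) [set x]]ecountC //.
  rewrite [ecount h [set x] [set x]]/ecount !big_set1 hi add0n -addnn; lia.
by rewrite oddD odd_double addbF; apply: IH.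
Qed.

Lemma degE (H : sgraph V) x : deg H x = (\sum_y H x y)%N.
Proof. by rewrite /deg -sum1dep_card big_mkcond; apply: eq_bigr => y _; case: (H x y). Qed.

Lemma sum_deg (H : sgraph V) A : (\sum_(x in A) deg H x)%N = ecount H A [set: V].
Proof.
by apply: eq_bigr => x _; rewrite degE; apply: eq_bigl => y; rewrite inE.
Qed.

Definition inner_rel (G : rel V) (W : {set V}) : rel V :=
  [rel x y | [&& x \in W, y \in W & G x y]].

Definition components (G : rel V) (W : {set V}) : {set {set V}} :=
  equivalence_partition (connect (inner_rel G W)) W.

Lemma inner_connect_equiv (G : sgraph V) (W : {set V}) :
  {in W & &, equivalence_rel (connect (inner_rel G W))}.
Proof.
have sy : connect_sym (inner_rel G W).
  by apply: sym_connect_sym => x y; rewrite /inner_rel /= (adj_sym G x) andbCA.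
by move=> x y z _ _ _; split; [exact: connect0|move=> xy; exact: same_connect].
Qed.

Lemma components_partition (G : sgraph V) W : partition (components G W) W.
Proof. exact: equivalence_partitionP (@inner_connect_equiv G W). Qed.

Lemma component_sub (G : sgraph V) W K : K \in components G W -> K \subset W.
Proof.
move=> KP; have /and3P[/eqP <- _ _] := components_partition G W.
exact: bigcup_sup.
Qed.

Lemma component_connect (G : sgraph V) W K x y : K \in components G W ->
  x \in K -> y \in W -> (y \in K) = connect (inner_rel G W) x y.
Proof.
move=> KP xK yW; have /and3P[_ tI _] := components_partition G W.
have xW : x \in W by apply: subsetP (component_sub KP) _ xK.
rewrite -(pblock_equivalence_partition (@inner_connect_equiv G W) xW yW).
by rewrite (def_pblock tI KP xK).
Qed.

Lemma component_closed (G : sgraph V) W K x y : K \in components G W ->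
  x \in K -> y \in W -> G x y -> y \in K.
Proof.
move=> KP xK yW xy; rewrite (component_connect KP xK yW); apply: connect1.
by rewrite /inner_rel /= xy yW (subsetP (component_sub KP)).
Qed.

End Counting.

Section EdgeType.
Variables (V : finType) (G : sgraph V).

Definition edge_type : finType := {e : {set V} | e \in edges G}.
Definition ends (e : edge_type) : {set V} := val e.

Lemma edgesP x y : ([set x; y] \in edges G) = G x y.
Proof.
apply/imsetP/idP => [[[a b]]|xy]; last by exists (x, y); rewrite ?inE.
rewrite inE /= => ab /setP eq.
have := eq x; have := eq y; have := eq a; have := eq b.
rewrite !inE !eqxx ?orbT /=.
have nab : a != b by apply: contraTneq ab => ->; rewrite adj_irr.
move=> h1 h2 h3 h4.
have [xa|xa] := eqVneq x a.
  subst x; move: h1; by rewrite (eq_sym b a) (negPf nab) /= => /eqP <-.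
move: h4; rewrite (negPf xa) /= => /esym/eqP xb; subst x.
by move: h2; rewrite (negPf nab) /= => /eqP <-; rewrite (adj_sym G).
Qed.

Lemma card_ends e : #|ends e| = 2.
Proof.
rewrite /ends; case/imsetP: (valP e) => -[a b]; rewrite inE /= => ab ->.
by rewrite cards2; case: eqP ab => // ->; rewrite adj_irr.
Qed.

Definition sub_rel (N : {set edge_type}) : rel V :=
  fun x y => [exists e in N, ends e == [set x; y]].

Lemma sub_rel_sym N : symmetric (sub_rel N).
Proof. by move=> x y; apply: eq_existsb => e; rewrite setUC. Qed.

Lemma sub_rel_irr N : irreflexive (sub_rel N).
Proof.
move=> x; apply/negbTE/exists_inP => -[e _ /eqP eE].
by have := card_ends e; rewrite eE setUid cards1.
Qed.

Definition subgraph N : sgraph V := SGraph (sub_rel_sym N) (sub_rel_irr N).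

Lemma subgraph_sub N : subrel (subgraph N) G.
Proof.
move=> x y /exists_inP[e _ /eqP eE]; rewrite -edgesP -eE.
exact: valP.
Qed.

Lemma subgraphT : subgraph [set: edge_type] =2 G.
Proof.
move=> x y; apply/idP/idP; first exact: subgraph_sub.
move=> xy; have h : [set x; y] \in edges G by rewrite edgesP.
by apply/exists_inP; exists (Sub [set x; y] h : edge_type); rewrite ?inE /ends ?SubK.
Qed.

Lemma deg_subgraph N v : deg (subgraph N) v = mdeg ends N v.
Proof.
rewrite /deg /mdeg.
have inj1 : injective (fun w => [set v; w]).
  move=> w w' /setP eq; have := eq w; have := eq w'; rewrite !inE !eqxx !orbT.
  case: (eqVneq w v) => [->|nw] /=; last by move=> _ /esym/eqP.
  by case: (eqVneq w' v) => [-> //|_] /eqP.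
rewrite -(card_imset _ inj1) -(card_imset [set e in N | v \in ends e] val_inj).
congr #|pred_of_set _|; apply/setP => A; apply/imsetP/imsetP.
  case=> w; rewrite inE => /exists_inP[e eN /eqP eE] ->.
  by exists e; [rewrite inE eN eE !inE eqxx|rewrite -eE].
case=> e; rewrite inE => /andP[eN ve] ->.
have [w eE vw] := other_end card_ends ve.
by exists w => //; rewrite inE; apply/exists_inP; exists e; rewrite ?eE.
Qed.

Lemma fdegE v : fdeg ends v = deg G v.
Proof.
rewrite /fdeg -deg_subgraph /deg; congr #|pred_of_set _|; apply/setP => w.
by rewrite !inE subgraphT.
Qed.

End EdgeType.

Lemma devz_parity g f d : gap_even g f -> (2 %| devz g f d - (f - d))%Z.
Proof.
move=> ok; have [k [? ?]] := gap_evenE ok; apply/dvdzP.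
case: (devz_cases d ok) => [[? ?]|[? ?]|[? ? [q ?]]|[? ? [q ?]]].
- by exists (- k); lia.
- by exists (d - f); lia.
- by exists (- q); lia.
- by exists (- q); lia.
Qed.

Lemma Posz_sum (V : finType) (A : {set V}) (F : V -> nat) :
  ((\sum_(x in A) F x)%N)%:Z = \sum_(x in A) (F x)%:Z.
Proof. exact: (big_morph Posz PoszD). Qed.

(** With all edges to [T] chosen and none to [S], the degrees in [K] sum to [ecount G K T] modulo 2;
    an odd component therefore cannot have total deviation 0. *)
Definition odd_component (V : finType) (G : rel V) (f : V -> int) (T K : {set V}) :=
  ~~ (2 %| (ecount G K T)%:Z + \sum_(v in K) f v)%Z.

Section PlacedCount.
Variables (V : finType) (G h : sgraph V) (S T : {set V}).
Hypothesis hG : subrel h G.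
Hypothesis hS : forall x y, x \in S -> y \notin T -> ~~ h x y.
Hypothesis hT : forall x y, x \in T -> y \notin S -> h x y = G x y.
Local Notation W := (~: (S :|: T)).

Lemma placed_S_cost : (\sum_(x in S) deg h x)%N = ecount h S T.
Proof.
apply: eq_bigr => x xS; rewrite degE [RHS]big_mkcond /=; apply: eq_bigr => y _.
by case: ifPn => // yT; rewrite (negPf (hS xS yT)).
Qed.

Lemma placed_T_cost :
  (\sum_(x in T) deg G x + ecount h S T = \sum_(x in T) deg h x + ecount G S T)%N.
Proof.
rewrite (ecountC _ _ (adj_sym h)) (ecountC _ _ (adj_sym G)) -!big_split /=.
apply: eq_bigr => x xT; rewrite !degE.
rewrite (bigID (mem S)) /= [in RHS](bigID (mem S)) /=.
have -> : (\sum_(y | y \notin S) G x y = \sum_(y | y \notin S) h x y)%N.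
  by apply: eq_bigr => y yS; rewrite hT.
lia.
Qed.

Lemma placed_component_deg K : K \in components G W ->
  (\sum_(x in K) deg h x = ecount h K K + ecount G K T)%N.
Proof.
move=> KP; rewrite -big_split /=; apply: eq_bigr => x xK; rewrite degE.
have KW := subsetP (component_sub KP).
have := KW _ xK; rewrite !inE negb_or => /andP[xS xT].
rewrite [X in (X + _)%N]big_mkcond [X in (_ + X)%N]big_mkcond -big_split /=.
apply: eq_bigr => y _; case: ifPn => yK.
  have := KW _ yK; rewrite !inE negb_or => /andP[_ /negPf ->].
  by rewrite addn0.
case: ifPn => yT; first by rewrite add0n (adj_sym h) (adj_sym G) hT.
case: (boolP (y \in S)) => yS; first by rewrite (adj_sym h) (negPf (hS yS xT)).
suff /negPf -> : ~~ h x y by [].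
apply: contra yK => /hG; apply: component_closed KP xK _.
by rewrite !inE negb_or yS.
Qed.

End PlacedCount.

(** * The barrier inequality for parity factors *)

Section ParityFactor.
Variables (V : finType) (G : sgraph V) (g f : V -> int).
Hypothesis ok : forall v, gap_even (g v) (f v).

Lemma dvd2_sum_dev (N : {set edge_type G}) (K : {set V}) :
  (2 %| \sum_(v in K) dev (@ends V G) g f N v
        - (\sum_(v in K) f v - (\sum_(v in K) deg (subgraph N) v)%N%:Z))%Z.
Proof.
rewrite Posz_sum -!sumrB; apply: rpred_sum => v _.
by rewrite deg_subgraph; apply: devz_parity.
Qed.

Section Placed.
Variables (S T : {set V}) (N : {set edge_type G}).
Hypothesis dis : [disjoint S & T].
Hypothesis placed : misplaced (@ends V G) S T N = set0.
Local Notation h := (subgraph N).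
Local Notation W := (~: (S :|: T)).

Lemma placed_S x y : x \in S -> y \notin T -> ~~ h x y.
Proof.
move=> xS yT; apply/exists_inP => -[e eN /eqP eE].
have [hS _] := placedP dis placed eE.
by have := hS xS yT; rewrite eN.
Qed.

Lemma placed_T x y : x \in T -> y \notin S -> h x y = G x y.
Proof.
move=> xT yS; apply/idP/idP => [|xy]; first exact: subgraph_sub.
have := subgraphT G x y; rewrite xy => /exists_inP[e _ /eqP eE].
have [_ hT] := placedP dis placed eE.
by apply/exists_inP; exists e; rewrite ?eE //; apply: hT.
Qed.

Lemma placed_component_dev K :
  (forall v L, v \notin S :|: T ->
     opt (@ends V G) (lift_bound (@ends V G) S T g) (lift_bound (@ends V G) S T f) L ->
     0 < dev (@ends V G) (lift_bound (@ends V G) S T g) (lift_bound (@ends V G) S T f) L v ->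
     flexible (@ends V G) (lift_bound (@ends V G) S T g) (lift_bound (@ends V G) S T f) v) ->
  opt (@ends V G) (lift_bound (@ends V G) S T g) (lift_bound (@ends V G) S T f) N ->
  K \in components G W ->
  \sum_(v in K) dev (@ends V G) g f N v <= (odd_component G f T K)%:Z.
Proof.
move=> hD oN KP; have KW := subsetP (component_sub KP).
have KST v : v \in K -> v \notin S :|: T by move=> /KW; rewrite inE.
case: (boolP [exists u in K, 0 < dev (@ends V G) g f N u]); last first.
  move=> /exists_inPn n0; rewrite big1 // => v vK.
  by apply/eqP; rewrite eq_le dev_ge0 // andbT leNgt n0.
case/exists_inP => u uK du.
have du' : 0 < dev (@ends V G) (lift_bound (@ends V G) S T g)
    (lift_bound (@ends V G) S T f) N u by rewrite dev_lift_W // KST.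
have okST := @lift_ok _ _ (@ends V G) g f ok S T.
have u1 : dev (@ends V G) g f N u = 1.
  have := flexible_dev_le1 (@card_ends V G) okST (hD _ _ (KST _ uK) oN du') oN.
  by rewrite dev_lift_W ?KST //; move: du; clear; lia.
have sum1 : \sum_(v in K) dev (@ends V G) g f N v = 1.
  rewrite (bigD1 u) //= u1 big1 ?addr0 // => v /andP[vK vu].
  apply/eqP; rewrite eq_le dev_ge0 // andbT leNgt; apply/negP => dv.
  have cn : connect (inner_rel G W) u v by rewrite -(component_connect KP) // KW.
  apply: (component_dev_le1 (@card_ends V G) ok hD _ oN cn (KST _ uK) _ du').
  - move=> x y /and3P[xW yW xy]; rewrite !inE in xW yW; rewrite !inE; split=> //.
      by apply: contraTneq xy => ->; rewrite adj_irr.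
    have := subgraphT G x y; rewrite xy => /exists_inP[e _ /eqP eE].
    by exists e.
  - by rewrite eq_sym.
  - by rewrite dev_lift_W // KST.
rewrite sum1; suff -> : odd_component G f T K by [].
have := dvd2_sum_dev N K; rewrite sum1.
rewrite (placed_component_deg (@subgraph_sub V G N) placed_S placed_T KP).
have := handshake K (adj_sym h) (adj_irr h); rewrite -dvdn2 => /dvdnP[q ->].
rewrite /odd_component => /dvdzP[p eq]; apply/negP => /dvdzP[r eq2].
move: eq eq2; set a := \sum_(v in K) _; set b := ecount _ _ _.
by move: a b p q r; clear; lia.
Qed.

End Placed.

Theorem parity_factor_or_barrier : (2 %| \sum_v f v)%Z ->
  (exists H, parity_factor G g f H) \/
  exists S T : {set V}, [disjoint S & T] /\
    2 + \sum_(v in S) f v + \sum_(v in T) ((deg G v)%:Z - g v)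
      <= (ecount G S T)%:Z
         + #|[set K in components G (~: (S :|: T)) | odd_component G f T K]|%:Z.
Proof.
move=> evf; have [M oM] := exists_opt (@ends V G) g f.
have dev0 v : 0 <= dev (@ends V G) g f M v by exact: dev_ge0.
have ev : (2 %| cost (@ends V G) g f M)%Z.
  have := dvd2_sum_dev M [set: V].
  have sumT (F : V -> int) : \sum_(v in [set: V]) F v = \sum_v F v.
    by apply: eq_bigl => v; rewrite inE.
  rewrite !sumT -/(cost _ g f M) sum_deg.
  have := handshake [set: V] (adj_sym (subgraph M)) (adj_irr (subgraph M)).
  rewrite -dvdn2 => /dvdnP[q ->]; case/dvdzP: evf => p ->.
  case/dvdzP=> r; move: (cost _ _ _ _) => c eq; apply/dvdzP.
  by exists (r + p - q%:Z); move: eq; clear; lia.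
have [c0|c0] := eqVneq (cost (@ends V G) g f M) 0.
  left; exists (subgraph M); split; first exact: subgraph_sub.
  move=> v; rewrite deg_subgraph.
  have d0 : dev (@ends V G) g f M v = 0.
    by apply: (psumr_eq0P _ c0) => // i _; exact: dev0.
  move: d0; rewrite /dev; set d := (mdeg _ _ _)%:Z.
  case: (devz_cases d (ok v)) => [[lt ->]|[lt ->]|[gdf _ [k fE]]|[_ -> _]] //.
  - by move=> /eqP; rewrite subr_eq0 => /eqP e; rewrite e ltxx in lt.
  - by move=> /eqP; rewrite subr_eq0 => /eqP e; rewrite e ltxx in lt.
  move=> _; split=> //; apply/eqP; rewrite eqz_mod_dvd; apply/dvdzP.
  by exists (- k); rewrite fE; clear; lia.
right; have [S [T [dis inv hD]]] := exists_barrier (@card_ends V G) ok.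
have [N oN pN] := exists_placed_opt (@card_ends V G) ok dis.
exists S, T; split=> //.
have c2 : 2 <= cost (@ends V G) g f M.
  have : 0 <= cost (@ends V G) g f M by apply: sumr_ge0 => v _; exact: dev0.
  case/dvdzP: ev c0 => q ->; clear; lia.
have := inv M N oM oN.
(* An edge between [S] and [T] is paid for at its end in [S] if chosen and at its end in [T] if not;
   since [N] is placed, no other edge is paid for there. *)
have -> : cost (@ends V G) (lift_bound (@ends V G) S T g) (lift_bound (@ends V G) S T f) N
    = (ecount G S T)%:Z + \sum_(v in ~: (S :|: T)) dev (@ends V G) g f N v.
  rewrite /cost (bigID (mem (S :|: T))) /=; congr (_ + _); last first.
    by apply: eq_big => [v|v vST]; rewrite ?inE ?dev_lift_W // -in_setU.
  rewrite (eq_bigl _ _ (fun v => in_setU v S T)) bigU //=.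
  rewrite (eq_bigr _ (fun v vS => dev_lift_S _ g f T N vS)).
  rewrite (eq_bigr _ (fun v vT => dev_lift_T _ g f dis N vT)).
  rewrite sumrB -!Posz_sum.
  have -> : (\sum_(v in T) fdeg (@ends V G) v = \sum_(v in T) deg G v)%N.
    by apply: eq_bigr => v _; rewrite fdegE.
  have degh (A : {set V}) : (\sum_(v in A) mdeg (@ends V G) N v
      = \sum_(v in A) deg (subgraph N) v)%N.
    by apply: eq_bigr => v _; rewrite deg_subgraph.
  rewrite !degh (placed_S_cost (placed_S dis pN)).
  have := placed_T_cost (placed_T dis pN).
  move: (ecount _ _ _) (ecount _ _ _) (\sum_(_ in _) _)%N (\sum_(_ in _) _)%N.
  by clear; lia.
have part := components_partition G (~: (S :|: T)).
have : \sum_(v in ~: (S :|: T)) dev (@ends V G) g f N v <=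
  #|[set K in components G (~: (S :|: T)) | odd_component G f T K]|%:Z.
  have -> : \sum_(v in ~: (S :|: T)) dev (@ends V G) g f N v
    = \sum_(K in components G (~: (S :|: T))) \sum_(v in K) dev (@ends V G) g f N v.
    by case/and3P: part => /eqP cov tI _; rewrite -big_trivIset // cov.
  have -> : #|[set K in components G (~: (S :|: T)) | odd_component G f T K]|%:Z
    = \sum_(K in components G (~: (S :|: T))) (odd_component G f T K)%:Z.
    rewrite -Posz_sum; congr Posz; rewrite -sum1dep_card big_mkcondr /=.
    by apply: eq_bigr => K _; case: (odd_component _ _ _ _).
  by apply: ler_sum => K KP; exact: (placed_component_dev dis pN hD oN KP).
have -> : \sum_(v in T) ((fdeg (@ends V G) v)%:Z - g v)
    = \sum_(v in T) ((deg G v)%:Z - g v) by apply: eq_bigr => v _; rewrite fdegE.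
move: (\sum_(v in T) _) (\sum_(v in ~: _) _) (\sum_(v in S) _) (cost _ _ _ _) c2.
by move: (ecount _ _ _) (#|_|); clear; lia.
Qed.

End ParityFactor.

(** * Test vectors on components with few outgoing edges *)

Section Rayleigh.
Variables (R : realType) (V : finType) (G : sgraph V) (K : {set V}).

Definition nonadj : rel V := fun x w => (x != w) && ~~ G x w.
Definition indeg x : nat := (\sum_(w in K) G x w)%N.
Definition codeg x : nat := (\sum_(w in K) nonadj x w)%N.

Lemma nonadj_sym : symmetric nonadj.
Proof. by move=> x w; rewrite /nonadj eq_sym (adj_sym G). Qed.

Lemma indeg_codeg x : x \in K -> (indeg x + codeg x + 1 = #|K|)%N.
Proof.
move=> xK; rewrite /indeg /codeg -sum1_card -big_split /= [RHS](bigD1 x) //=.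
rewrite (bigD1 x) //= /nonadj adj_irr eqxx /= add0n addn1 add1n; congr _.+1.
by apply: eq_bigr => w /andP[_ wx]; rewrite eq_sym wx; case: (G x w).
Qed.

Lemma adj_sum_compl (y : V -> R) x : x \in K ->
  \sum_(w in K) (G x w)%:R * y w
  = \sum_(w in K) y w - y x - \sum_(w in K) (nonadj x w)%:R * y w.
Proof.
move=> xK; rewrite (bigD1 x) //= adj_irr mul0r add0r.
rewrite [\sum_(w in K) y w](bigD1 x) //= [X in _ - X](bigD1 x) //=.
rewrite /nonadj eqxx /= mul0r add0r [y x + _]addrC addrK -sumrB.
apply: eq_bigr => w /andP[_ wx]; rewrite eq_sym wx /=.
by case: (G x w) => /=; ring.
Qed.

Lemma rayleigh_of_vector (a : R) (y : V -> R) (x0 : V) : x0 \in K ->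
  (forall x, x \in K -> 0 < y x) ->
  a * (\sum_(x in K) y x ^+ 2)
    <= \sum_(x in K) y x * \sum_(w in K) (G x w)%:R * y w ->
  rayleigh_ge G K a.
Proof.
move=> xK y0 le; exists y; split.
  rewrite (bigD1 x0) //=; apply: ltr_wpDr; last by rewrite exprn_gt0 ?y0.
  by apply: sumr_ge0 => x _; rewrite sqr_ge0.
apply: le_trans le _; rewrite le_eqVlt; apply/orP; left; apply/eqP.
apply: eq_bigr => x _; rewrite mulr_sumr; apply: eq_bigr => w _; ring.
Qed.

Lemma rayleigh_avg (a : R) : (0 < #|K|)%N ->
  a * #|K|%:R <= (ecount G K K)%:R -> rayleigh_ge G K a.
Proof.
move=> /card_gt0P[x0 x0K] le.
apply: (@rayleigh_of_vector _ (fun _ => 1) x0) => //.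
apply: le_trans (le_trans le _).
  rewrite le_eqVlt; apply/orP; left; apply/eqP; congr (_ * _).
  by rewrite -sum1_card natr_sum; apply: eq_bigr => x _; rewrite expr1n.
rewrite le_eqVlt; apply/orP; left; apply/eqP.
rewrite natr_sum; apply: eq_bigr => x _; rewrite natr_sum mul1r.
by apply: eq_bigr => w _; rewrite mulr1.
Qed.

(* The Rayleigh quotient of b - codeg.  The cross terms over nonadjacent pairs
   are bounded by 2 u v <= u^2 + v^2, and the integrality of codeg enters
   through (codeg - c) (codeg - c - 1) >= 0. *)
Lemma rayleigh_codeg (a b : R) (c : nat) : (0 < #|K|)%N ->
  b = a + 2 + 2 * c%:R -> #|K|%:R - 1 < b ->
  (1 + a) * b + c%:R * (c%:R + 1)
    <= b * #|K|%:R - (\sum_(x in K) (codeg x)%:R) ->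
  rayleigh_ge G K a.
Proof.
move=> /card_gt0P[x0 x0K] bE ltb le.
pose y x : R := b - (codeg x)%:R.
have y0 x : x \in K -> 0 < y x.
  move=> xK; rewrite /y subr_gt0; apply: le_lt_trans ltb.
  rewrite -(indeg_codeg xK) !natrD addrK lerDr //.
apply: (@rayleigh_of_vector _ y x0) => //.
have YE : \sum_(x in K) y x = b * #|K|%:R - \sum_(x in K) (codeg x)%:R.
  by rewrite sumrB sumr_const mulr_natr.
set Y := \sum_(x in K) y x in YE.
have cross : \sum_(x in K) y x * (\sum_(w in K) (nonadj x w)%:R * y w)
    <= \sum_(x in K) (codeg x)%:R * y x ^+ 2.
  pose F x w : R := (nonadj x w)%:R * y x ^+ 2.
  have FE : \sum_(x in K) (codeg x)%:R * y x ^+ 2 = \sum_(x in K) \sum_(w in K) F x w.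
    by apply: eq_bigr => x _; rewrite /codeg natr_sum mulr_suml.
  have FE2 : \sum_(x in K) \sum_(w in K) F x w = \sum_(x in K) \sum_(w in K) F w x.
    by rewrite exchange_big.
  suff : 2 * \sum_(x in K) y x * (\sum_(w in K) (nonadj x w)%:R * y w)
    <= \sum_(x in K) (codeg x)%:R * y x ^+ 2 + \sum_(x in K) (codeg x)%:R * y x ^+ 2.
    by lra.
  rewrite FE {2}FE2 -big_split /= mulr_sumr; apply: ler_sum => x _.
  rewrite -big_split /= mulrA mulr_sumr; apply: ler_sum => w _.
  rewrite /F (nonadj_sym w x); case: (nonadj x w) => /=; last by lra.
  by have := sqr_ge0 (y x - y w); nra.
have -> : \sum_(x in K) y x * (\sum_(w in K) (G x w)%:R * y w)
  = \sum_(x in K) y x * (Y - y x) - \sum_(x in K) y x * (\sum_(w in K) (nonadj x w)%:R * y w).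
  by rewrite -sumrB; apply: eq_bigr => x xK; rewrite adj_sum_compl // mulrBr.
suff : a * \sum_(x in K) y x ^+ 2 + \sum_(x in K) (codeg x)%:R * y x ^+ 2
  <= \sum_(x in K) y x * (Y - y x) by lra.
rewrite mulr_sumr -big_split /=; apply: ler_sum => x xK.
have -> : a * y x ^+ 2 + (codeg x)%:R * y x ^+ 2 = y x * ((a + (codeg x)%:R) * y x) by ring.
rewrite ler_pM2l ?y0 //.
have int2 : 0 <= ((codeg x)%:R - c%:R) * ((codeg x)%:R - c%:R - 1) :> R.
  have [le1|lt1] := leqP (codeg x) c.
    have : (codeg x)%:R <= c%:R :> R by rewrite ler_nat.
    by move=> h; apply: mulr_le0; lra.
  have : c%:R + 1 <= (codeg x)%:R :> R by rewrite natr1 ler_nat.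
  by move=> h; apply: mulr_ge0; lra.
(* For a codegree k, (1 + a + k)(b - k) equals (1 + a) b + c (c + 1) - (k - c)(k - c - 1) exactly
   when [b] is [a + 2 + 2 c], or k is 0. *)
rewrite -YE in le; rewrite /y.
nra.
Qed.

End Rayleigh.

(** * Equations and bounds for rho *)

Section RhoValues.
Variable R : realType.

(* The root (r - k + sqrt ((r + k)^2 - 4 z)) / 2 of (r - x) (x + k) = z. *)
Lemma quadratic_root_spec (r k z : R) : 0 <= r -> 1 <= k -> 0 <= z ->
  z < r + k - 1 ->
  let x := (r - k + Num.sqrt ((r + k) ^+ 2 - 4 * z)) / 2 in
  (r - x) * (x + k) = z /\ r - 1 < x <= r.
Proof.
move=> r0 k1 z0 zr x; rewrite /x {x}.
set D := (r + k) ^+ 2 - 4 * z; set t := Num.sqrt D.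
have D0 : 0 <= D.
  by rewrite /D; have := sqr_ge0 (r + k - 2); rewrite !expr2; nra.
have tt : t ^+ 2 = D by rewrite sqr_sqrtr.
have t0 : 0 <= t by rewrite sqrtr_ge0.
have t1 : r + k - 2 < t.
  rewrite ltNge; apply/negP => h; have : t ^+ 2 <= (r + k - 2) ^+ 2.
    by rewrite ler_sqr ?nnegrE //; apply: le_trans h.
  by rewrite tt /D !expr2; nra.
have t2 : t <= r + k.
  have rk : 0 <= r + k by lra.
  by rewrite -ler_sqr ?nnegrE // tt /D; lra.
split; last by apply/andP; split; lra.
have -> : (r - (r - k + t) / 2) * ((r - k + t) / 2 + k) = ((r + k) ^+ 2 - t ^+ 2) / 4.
  by field.
by rewrite tt /D; field.
Qed.

Lemma rho_even_spec (r eta : nat) : (0 < eta < r)%N -> ~~ odd r || ~~ odd eta ->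
  let x := rho R r eta in
  (r%:R - x) * (x + 2) = (eta %/ 2).*2%:R /\ r%:R - 1 < x <= r%:R.
Proof.
move=> /andP[e0 er] par x; rewrite /x {x} /rho par.
have -> : 8 * (eta %/ 2)%:R = 4 * (eta %/ 2).*2%:R :> R.
  by rewrite -mul2n natrM; ring.
apply: quadratic_root_spec => //; try lra.
have : ((eta %/ 2).*2 + 1 <= r)%N by lia.
rewrite -(ler_nat R) natrD; lra.
Qed.

Lemma rho_odd_spec (r eta : nat) : (2 < eta < r)%N -> odd r -> odd eta ->
  let x := rho R r eta in
  (r%:R - x) * (x + 3) = eta%:R /\ r%:R - 1 < x <= r%:R.
Proof.
move=> /andP[e3 er] or oe x; rewrite /x {x} /rho or oe /= e3.
apply: quadratic_root_spec => //; try lra.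
have : (eta + 1 <= r)%N by lia.
rewrite -(ler_nat R) natrD; lra.
Qed.

(** The cubic is -r (r - 1) at r - 1, equals r - 1 at r and stays positive beyond r, so its largest
    root lies in between. *)
Lemma rho_one_spec (r : nat) : odd r -> (1 < r)%N ->
  let x := rho R r 1 in
  x ^+ 3 - (r%:R - 2) * x ^+ 2 - 2 * r%:R * x + r%:R - 1 = 0 /\ r%:R - 1 < x <= r%:R.
Proof.
move=> or r1; rewrite /rho or /=.
have r3 : (3 <= r)%N by case: r or r1 => [|[|[|]]].
have r3R : 3 <= r%:R :> R by rewrite (ler_nat R 3).
set p : {poly R} := _ + _.
have pE z : p.[z] = z ^+ 3 - (r%:R - 2) * z ^+ 2 - 2 * r%:R * z + r%:R - 1.
  rewrite /p !(hornerD, hornerN, hornerZ, hornerXn, hornerX, hornerC).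
  by rewrite addrA.
have p0 : p != 0.
  apply/eqP => p0; have := pE r%:R; rewrite p0 horner0 => /esym.
  by move=> h; suff : (r%:R : R) - 1 = 0; [lra|rewrite -h; ring].
have [x0 x0I rx0] : exists2 x, x \in `[(r%:R - 1 : R), r%:R] & root p x.
  apply: poly_ivt; first lra.
  by rewrite !pE; apply/andP; split; nra.
have memE z : (z \in rootsR p) = root p z.
  by rewrite -(roots_on_rootsR p0) inE.
have x0r : x0 \in rootsR p by rewrite memE.
have lastP : last 0 (rootsR p) \in rootsR p /\ x0 <= last 0 (rootsR p).
  have := @sorted_roots R (- cauchy_bound p) (cauchy_bound p) p.
  rewrite -/(rootsR p).
  case E : (rootsR p) x0r => [//|u s] x0s srt.
  split; first by rewrite /= mem_last.
  have [i il <-] := nthP 0 x0s.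
  have -> : last 0 (u :: s) = nth 0 (u :: s) (size s) by rewrite -nth_last.
  apply: (sorted_leq_nth (leT := <=%R)) => //; rewrite ?inE //.
  - exact: le_trans.
  - by move: srt; rewrite lt_sorted_uniq_le => /andP[].
rewrite /largest_root; set x := last _ _ in lastP *.
case: lastP => xr x0x.
have px : p.[x] = 0 by apply/eqP; rewrite -[_ == _]memE.
split; first by rewrite -pE.
move: x0I; rewrite in_itv /= => /andP[x0l _].
have xl : r%:R - 1 <= x by apply: le_trans x0x.
move: px; rewrite pE => px.
apply/andP; split.
  rewrite lt_neqAle xl andbT; apply/eqP => h; move: px; rewrite -h => px.
  by nra.
by rewrite leNgt; apply/negP => h; nra.
Qed.

End RhoValues.

(** * Sets of minimum degree r with at most eta outgoing edges *)

Section Component.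
Variables (R : realType) (V : finType) (G : sgraph V) (K : {set V}) (r eta : nat).
Hypothesis K0 : (0 < #|K|)%N.
Hypothesis degK : forall x, x \in K -> (r <= deg G x)%N.
Hypothesis outK : (ecount G K (~: K) <= eta)%N.
Hypothesis eta_lt : (eta < r)%N.

Local Notation n := #|K|.
Local Notation e := (ecount G K K).
Local Notation out x := (\sum_(w in ~: K) G x w)%N.

Lemma deg_inout x : deg G x = (indeg G K x + out x)%N.
Proof.
rewrite degE (bigID (mem K)) /=; congr (_ + _)%N.
by apply: eq_bigl => w; rewrite inE.
Qed.

Lemma component_edges : (r * n <= e + eta)%N.
Proof.
apply: leq_trans (leq_add (leqnn _) outK); rewrite /ecount -big_split /=.
rewrite mulnC -sum_nat_const; apply: leq_sum => x xK.
by rewrite -[leqRHS]deg_inout degK.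
Qed.

Lemma component_even : ~~ odd e.
Proof. exact: handshake (adj_sym G) (adj_irr G). Qed.

(** With n at most r, every vertex sends at least r - n + 1 edges out of [K], and n (r - n + 1) is
    at least r, which exceeds [eta]. *)
Lemma component_card : (r < n)%N.
Proof.
rewrite ltnNge; apply/negP => le.
have le_e : (e <= n * n.-1)%N.
  rewrite -sum_nat_const /ecount; apply: leq_sum => x xK.
  by have := indeg_codeg G xK; rewrite /indeg; lia.
have := component_edges; have : (n * (r - n.-1) >= r)%N by nia.
nia.
Qed.

Lemma sum_codeg : (\sum_(x in K) codeg G K x + e = n * n.-1)%N.
Proof.
rewrite /ecount -big_split /= -sum_nat_const; apply: eq_bigr => x xK.
by have := indeg_codeg G xK; rewrite /indeg; lia.
Qed.

(** The equation of x = [rho] serves twice: for n = r + 1 its right side is the allowed sum of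
    codegrees, and for n at least r + 2, hence at least x + 2, it makes the average degree at least
    x. *)
Lemma component_rayleigh_even : (0 < eta)%N -> ~~ odd r || ~~ odd eta ->
  rayleigh_ge G K (rho R r eta).
Proof.
move=> e0 par; have [] := @rho_even_spec R r eta _ par; first by rewrite e0.
set x := rho R r eta; set m := (eta %/ 2)%N => xE /andP[x1 x2].
have edges : (r * n <= e + m.*2)%N.
  have := component_edges; have := component_even.
  have : ~~ odd r || ~~ odd eta -> ~~ odd (r * n) || ~~ odd eta.
    by rewrite oddM negb_and; case: (odd r); case: (odd eta); rewrite ?orbT.
  move/(_ par); rewrite /m; move: (r * n)%N; clear; lia.
have edgesR : r%:R * n%:R <= e%:R + m.*2%:R :> R.
  by rewrite -natrM -natrD ler_nat.
have := component_card; rewrite leq_eqVlt => /orP[/eqP nE|lt].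
  have nR : n%:R = r%:R + 1 :> R by rewrite -nE -natr1.
  apply: (@rayleigh_codeg R V G K x (x + 2) 0) => //; first by ring.
    by rewrite nR; lra.
  rewrite -natr_sum.
  have := sum_codeg; rewrite -nE /= => /(congr1 (fun k : nat => k%:R : R)).
  rewrite natrD natrM -!natr1; move: edgesR; rewrite nR; nra.
apply: rayleigh_avg => //; rewrite -/x.
have ltR : r%:R + 2 <= n%:R :> R by rewrite -(natrD _ r 2) ler_nat addn2.
nra.
Qed.

Lemma component_rayleigh_odd : (2 < eta)%N -> odd r -> odd eta ->
  rayleigh_ge G K (rho R r eta).
Proof.
move=> e3 or oe; have [] := @rho_odd_spec R r eta _ or oe; first by rewrite e3.
set x := rho R r eta => xE /andP[x1 x2].
have edges := component_edges.
have edgesR : r%:R * n%:R <= e%:R + eta%:R :> R.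
  by rewrite -natrM -natrD ler_nat.
have := component_card; rewrite leq_eqVlt => /orP[/eqP nE|].
  have nR : n%:R = r%:R + 1 :> R by rewrite -nE -natr1.
  apply: rayleigh_avg => //; rewrite -/x.
  have : (r * n + 1 <= e + eta)%N.
    have : ~~ odd (r * n) by rewrite oddM -nE /= or.
    by move: edges component_even oe; move: (r * n)%N; clear; lia.
  rewrite -(ler_nat R) !natrD natrM nR => h.
  have : 0 <= (1 - (r%:R - x)) ^+ 2 by exact: sqr_ge0.
  by rewrite expr2; nra.
rewrite leq_eqVlt => /orP[/eqP nE|lt].
  have nR : n%:R = r%:R + 2 :> R by rewrite -nE -(natrD _ r 2) addn2.
  (* On r + 2 vertices a vertex of degree r has codegree 1 plus its number of outgoing edges,
     typically 1 or 2; hence [c = 1]. *)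
  apply: (@rayleigh_codeg R V G K x (x + 4) 1) => //; first by ring.
    by rewrite nR; lra.
  rewrite -natr_sum.
  have := sum_codeg; rewrite -nE /= => /(congr1 (fun k : nat => k%:R : R)).
  rewrite natrD natrM -!natr1; move: edgesR; rewrite nR; nra.
apply: rayleigh_avg => //; rewrite -/x.
have ltR : r%:R + 3 <= n%:R :> R by rewrite -(natrD _ r 3) ler_nat addn3.
nra.
Qed.

Lemma component_rayleigh_one : odd r -> eta = 1%N -> rayleigh_ge G K (rho R r 1).
Proof.
move=> or eta1; have r1 : (1 < r)%N by rewrite -eta1.
have [] := @rho_one_spec R r or r1.
set mu := rho R r 1 => muE /andP[mu1 mu2].
have r3 : (3 <= r)%N by case: (r) or r1 => [|[|[|]]].
have r3R : 3 <= r%:R :> R by rewrite (ler_nat R 3).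
have edges := component_edges; rewrite eta1 in edges.
have avg : (r * n <= e)%N -> rayleigh_ge G K mu.
  rewrite -(ler_nat R) natrM => h; apply: rayleigh_avg => //.
  by apply: le_trans h; rewrite ler_wpM2r.
case: (boolP (odd n)) => [on|en]; last first.
  apply: avg; have : ~~ odd (r * n) by rewrite oddM (negPf en) andbF.
  by move: edges component_even; move: (r * n)%N; clear; lia.
have := component_card; rewrite leq_eqVlt => /orP[/eqP nE|].
  by move: on; rewrite -nE /= or.
rewrite leq_eqVlt => /orP[/eqP nE|lt]; last first.
  have ltR : r%:R + 4 <= n%:R :> R.
    rewrite -(natrD _ r 4) ler_nat; move: lt on or; clear; lia.
  apply: rayleigh_avg => //.
  have edgesR : r%:R * n%:R <= e%:R + 1 :> R by rewrite -natrM natr1 ler_nat -addn1.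
  have gap : 1 <= (r%:R - mu) * (r%:R + 4).
    rewrite leNgt; apply/negP; set d := r%:R - mu => dlt.
    have d0 : 0 <= d by rewrite /d; lra.
    have dE : r%:R - 1 = d * (r%:R ^+ 2 + 2 * r%:R) - d ^+ 2 * (2 * r%:R + 2) + d ^+ 3.
      by apply/eqP; rewrite -subr_eq0 -muE /d; apply/eqP; ring.
    have dsmall : d <= 1 / 7 by nra.
    (* Without the quadratic and cubic terms, (r - 1)(r + 4) < r^2 + 2 r would follow, that is r <
       4; so r = 3 needs the full equation. *)
    have [r4|r4] := leqP 5 r.
      have r5R : 5 <= r%:R :> R by rewrite (ler_nat R 5).
      have : d ^+ 3 <= d ^+ 2 * (2 * r%:R + 2) by rewrite exprSr ler_wpM2l ?sqr_ge0 //; lra.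
      by rewrite !expr2 in dE *; nra.
    have rE : r = 3%N by move: r3 r4 or; clear; lia.
    have r3E : r%:R = 3 :> R by rewrite rE.
    by rewrite r3E in dE dlt; move: dE dlt d0; rewrite !exprS expr0; nra.
  nra.
have [|] := boolP [forall x in K, codeg G K x <= 1]%N.
  move=> /forall_inP c1; apply: avg; rewrite mulnC -sum_nat_const; apply: leq_sum => x xK.
  by have := c1 x xK; have := indeg_codeg G xK; rewrite /indeg -nE; clear; lia.
case/forall_inPn => a aK; rewrite -ltnNge => ca.
(* A codegree above 1 requires an edge leaving [K], and there is at most one; so [a] is the only
   such vertex. *)
have outE x : x \in K -> (codeg G K x <= out x + 1)%N.
  move=> xK; have := degK xK; have := indeg_codeg G xK; rewrite deg_inout -nE; clear; lia.
have outsum : (\sum_(x in K) out x <= 1)%N by rewrite -eta1.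
have outs : (out a + \sum_(x in K | x != a) out x <= 1)%N by move: outsum; rewrite (bigD1 a).
have ca2 : codeg G K a = 2%N by have := outE a aK; move: outs ca; clear; lia.
have cx x : x \in K -> x != a -> (codeg G K x <= 1)%N.
  move=> xK xa; have := outE x xK.
  have : (out x <= \sum_(x in K | x != a) out x)%N by rewrite [leqRHS](bigD1 x) ?xK //= leq_addr.
  have := outE a aK; rewrite ca2; move: outs; clear; lia.
(* The complement of G on K is a path with centre a plus isolated edges and
   vertices; y is the Perron vector of the extremal graph, whose characteristic
   equation is the cubic defining mu. *)
pose B := [set w in K | nonadj G a w].
have BK w : w \in B -> w \in K by rewrite inE => /andP[].
have aB : a \notin B by rewrite inE /nonadj eqxx andbF.
have cardB : #|B| = 2%N.
  by rewrite -ca2 /codeg -sum1dep_card big_mkcondr.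
have onlya b w : b \in B -> w \in K -> nonadj G b w -> w = a.
  move=> bB wK nbw; apply/eqP; apply: contraTT (cx b (BK _ bB) _) => [wa|]; last first.
    by apply: contraNneq aB => <-.
  move: bB; rewrite inE => /andP[_]; rewrite nonadj_sym => nba.
  by rewrite -ltnNge /codeg (bigD1 a) //= (bigD1 w) ?wK //= nba nbw.
pose y x : R := if x == a then (r%:R - 1) * (mu - 1)
  else if x \in B then (r%:R - 1) * mu else mu * (mu - 1).
have ya : y a = (r%:R - 1) * (mu - 1) by rewrite /y eqxx.
have yB x : x \in B -> y x = (r%:R - 1) * mu.
  by move=> xB; rewrite /y xB; case: eqP xB aB => // -> ->.
have yZ x : x != a -> x \notin B -> y x = mu * (mu - 1).
  by move=> /negPf xa /negPf xB; rewrite /y xa xB.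
have y0 x : 0 < y x.
  by rewrite /y; case: ifP => _; [|case: ifP => _]; apply: mulr_gt0; lra.
have sumY : \sum_(x in K) y x = (r%:R - 1) * (mu - 1) + 2 * ((r%:R - 1) * mu)
    + (r%:R - 1) * (mu * (mu - 1)).
  have cardZ : #|[set x in K | (x != a) && (x \notin B)]| = (r - 1)%N.
    have -> : [set x in K | (x != a) && (x \notin B)] = K :\: (a |: B).
      by apply/setP => x; rewrite !inE negb_or andbC.
    rewrite cardsD (setIidPr _) ?cardsU1 ?aB ?cardB -?nE; first by clear; lia.
    by rewrite subUset sub1set aK; apply/subsetP => x; exact: BK.
  rewrite (bigD1 a) //= ya (bigID (mem B)) /= addrA; congr (_ + _ + _).
    rewrite (eq_big (mem B) (fun _ => (r%:R - 1) * mu)) => [|x|x /andP[_ xB]].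
    - by rewrite sumr_const cardB mulr_natl.
    - rewrite /=; case: (boolP (x \in B)) => xB; rewrite ?andbF // (BK _ xB) andbT.
      by apply: contraNneq aB => <-.
    - exact: yB.
  rewrite (eq_big (mem [set x in K | (x != a) && (x \notin B)]) (fun _ => mu * (mu - 1))).
  - by rewrite sumr_const cardZ -[LHS]mulr_natl natrB // (leq_trans _ r3).
  - by move=> x; rewrite /= inE andbA.
  - by move=> x /andP[/andP[_ xa] xB]; exact: yZ.
have nonadj_sum x v : (forall w, w \in K -> nonadj G x w -> y w = v) ->
    \sum_(w in K) (nonadj G x w)%:R * y w = (codeg G K x)%:R * v.
  move=> h; rewrite /codeg natr_sum mulr_suml; apply: eq_bigr => w wK.
  by case: (boolP (nonadj G x w)) => [/(h _ wK) ->|_]; rewrite ?mul0r.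
apply: (@rayleigh_of_vector R V G K mu y a aK) => [x _|]; first exact: y0.
rewrite mulr_sumr; apply: ler_sum => x xK.
rewrite expr2 mulrCA ler_pM2l // adj_sum_compl // sumY.
have [->|xa] := eqVneq x a.
  rewrite (@nonadj_sum _ ((r%:R - 1) * mu)) ?ca2 ?ya; first by nra.
  by move=> w wK nw; apply: yB; rewrite inE wK.
case: (boolP (x \in B)) => xB.
  rewrite (@nonadj_sum _ ((r%:R - 1) * (mu - 1))) ?yB //; last first.
    by move=> w wK nw; rewrite (onlya x w).
  have : (codeg G K x)%:R <= 1 :> R by rewrite (ler_nat R _ 1) cx.
  have : 0 < (r%:R - 1) * (mu - 1) by rewrite -ya.
  by nra.
(* For codegree 1 the rows of [B] balance for every value of [mu], like that of [a]; the rows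
   treated here balance exactly when the cubic vanishes. *)
rewrite (@nonadj_sum _ (mu * (mu - 1))) ?yZ //; last first.
  move=> w wK nw; apply: yZ.
    by apply: contraNneq xB => wa; rewrite inE xK nonadj_sym -wa.
  apply: contraNN xa => wB; apply/eqP; apply: (onlya w) => //.
  by rewrite nonadj_sym.
have : (codeg G K x)%:R <= 1 :> R by rewrite (ler_nat R _ 1) cx.
have : 0 < mu * (mu - 1) by rewrite -(yZ x).
by nra.
Qed.

Lemma component_rayleigh : (0 < eta)%N -> rayleigh_ge G K (rho R r eta).
Proof.
move=> e0; case: (boolP (~~ odd r || ~~ odd eta)) => [|par].
  exact: component_rayleigh_even.
move: par; rewrite negb_or !negbK => /andP[or oe].
have [e3|e3] := ltnP 2 eta; first exact: component_rayleigh_odd.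
have e1 : eta = 1%N by case: (eta) e0 oe e3 => [|[|[|]]].
by rewrite e1; apply: component_rayleigh_one.
Qed.

End Component.

(** * Counting components with few outgoing edges *)

Section Ceil.
Variable R : realType.

Lemma ceiln_le (x : R) (k : nat) : 0 < x -> (ceiln x <= k)%N = (x <= k%:R).
Proof.
move=> x0; rewrite /ceiln -[k%:R]/((k%:Z)%:~R) -ceil_le_int -lez_nat.
by rewrite gez0_abs // ceil_ge0 (lt_le_trans _ (ltW x0)) // ltrN10.
Qed.

Lemma ceiln_gt0 (x : R) : 0 < x -> (0 < ceiln x)%N.
Proof. by move=> x0; rewrite ltnNge ceiln_le // -ltNge. Qed.

End Ceil.

Section Cuts.
Variables (V : finType) (G : sgraph V).

Lemma min_deg_le v : (min_deg G <= deg G v)%N.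
Proof.
rewrite /min_deg; have : v \in index_enum V by rewrite mem_index_enum.
elim: (index_enum V) => // x s IH; rewrite inE big_cons geq_min.
by case/orP => [/eqP <-|/IH ->]; rewrite ?leqnn ?orbT.
Qed.

Lemma edge_connected_cut h (K : {set V}) x y : edge_connected h G ->
  x \in K -> y \notin K -> (h <= ecount G K (~: K))%N.
Proof.
move=> hG xK yK; rewrite leqNgt; apply/negP => lt.
pose P := [set p : V * V | [&& p.1 \in K, p.2 \in ~: K & G p.1 p.2]].
pose F := [set [set p.1; p.2] | p in P].
have cardP : #|P| = ecount G K (~: K).
  rewrite /ecount pair_big_dep /= -sum1dep_card big_mkcond [RHS]big_mkcond /=.
  by apply: eq_bigr => -[a b] _ /=; case: (a \in K); case: (b \in ~: K); case: (G a b).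
have Fsub : F \subset edges G.
  apply/subsetP => A /imsetP[p]; rewrite inE => /and3P[_ _ pG] ->.
  by apply/imsetP; exists p; rewrite ?inE.
have Fc : (#|F| < h)%N.
  by apply: leq_ltn_trans lt; rewrite -cardP; apply: leq_imset_card.
have := hG F Fsub Fc x y.
have cl : closed (del_edges G F) (mem K).
  have one a b : del_edges G F a b -> a \in K -> b \in K.
    move=> /andP[ab nF] aK; apply: contraNT nF => bK.
    by apply/imsetP; exists (a, b); rewrite // !inE aK bK.
  move=> a b ab; apply/idP/idP; first exact: one.
  apply: one; move: ab => /andP[ab nF].
  by rewrite /del_edges /= (adj_sym G) ab setUC.
by move/(closed_connect cl) => /=; rewrite xK (negPf yK).
Qed.

Lemma ecount_cover (A : {set V}) (P : {set {set V}}) : trivIset P ->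
  ecount G A (cover P) = (\sum_(K in P) ecount G A K)%N.
Proof.
move=> tP; rewrite /ecount [RHS]exchange_big /=; apply: eq_bigr => x _.
exact: big_trivIset.
Qed.

Lemma ecount_subr (A B C : {set V}) : B \subset C -> (ecount G A B <= ecount G A C)%N.
Proof.
move=> BC; apply: leq_sum => x _; rewrite [leqLHS]big_mkcond [leqRHS]big_mkcond /=.
apply: leq_sum => y _; case: ifP => // yB; by rewrite (subsetP BC _ yB).
Qed.

Lemma component_cut (S T K : {set V}) : [disjoint S & T] ->
  K \in components G (~: (S :|: T)) ->
  ecount G K (~: K) = (ecount G K S + ecount G K T)%N.
Proof.
move=> dis KP; rewrite -ecountUr //; apply: eq_bigr => x xK.
rewrite [LHS]big_mkcond [RHS]big_mkcond /=; apply: eq_bigr => y _.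
have := subsetP (component_sub KP) y; rewrite !in_setC.
case: (boolP (y \in K)) => yK /=; first by move=> /(_ isT) /negPf ->.
move=> _; case: ifPn => // yST; case: (boolP (G x y)) => // xy.
by move: yK; rewrite (component_closed KP xK _ xy) // in_setC.
Qed.

End Cuts.

(** The hypothesis on [term] is what the cases other than (b) share; [t] stands for whichever of the
    weights bounds the positive terms. *)
Lemma component_terms_lt2 (R : realType) (V : finType) (G : sgraph V)
    (W : {set V}) (Q : {set {set V}}) (term : {set V} -> R) (t : R) (k : nat) :
  0 < t < 1 -> spectral_cond G t k -> Q \subset components G W ->
  {in Q, forall K, term K <= 0 \/
    (k <= ecount G K (~: K))%N /\ term K <= 1 - t * (ecount G K (~: K))%:R} ->
  \sum_(K in Q) term K < 2.
Proof.
move=> /andP[t0 t1] cond QC hterm.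
case: cond => [le|[lt le_deg lam]].
  apply: le_lt_trans (ltr0n R 2); apply: sumr_le0 => K KQ.
  case: (hterm K KQ) => // -[kK]; move/le_trans; apply; rewrite subr_le0.
  have : 1 <= t * k%:R by move: le; rewrite ler_pdivrMr // mulrC.
  move/le_trans; apply; rewrite ler_wpM2l ?ler_nat //; exact: ltW.
rewrite ltNge; apply/negP => ge2.
have tk : t * k%:R < 1 by move: lt; rewrite ltr_pdivlMr // mulrC.
have t1' : 1 < 1 / t by rewrite ltr_pdivlMr // mul1r.
pose P := [set K in Q | 0 < term K].
have PQ K : K \in P -> K \in Q by rewrite inE => /andP[].
have PP K : K \in P ->
    (k <= ecount G K (~: K))%N /\ term K <= 1 - t * (ecount G K (~: K))%:R.
  by rewrite inE => /andP[KQ pos]; case: (hterm K KQ) => //; rewrite leNgt pos.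
have sumP : \sum_(K in Q) term K <= (1 - t * k%:R) * #|P|%:R.
  apply: (@le_trans _ _ (\sum_(K in P) (1 - t * k%:R))); last first.
    by rewrite sumr_const -[leLHS]mulr_natr.
  rewrite big_mkcond [leRHS]big_mkcond /=; apply: ler_sum => K _.
  rewrite inE; case: ifP => //= KQ; case: ifPn => [pos|]; last by rewrite -leNgt.
  have [kK] : (k <= ecount G K (~: K))%N /\ term K <= 1 - t * (ecount G K (~: K))%:R.
    by apply: PP; rewrite inE KQ.
  move/le_trans; apply; rewrite lerD2l lerN2 ler_wpM2l ?ler_nat //; exact: ltW.
have m0 : 0 < 2 / (1 - t * k%:R) by rewrite divr_gt0 // subr_gt0.
have cardP : (0 < ceiln (2 / (1 - t * k%:R)) <= #|P|)%N.
  rewrite ceiln_gt0 // ceiln_le // ler_pdivrMr ?subr_gt0 // mulrC.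
  exact: le_trans sumP.
have part := components_partition G W.
suff : rho R (min_deg G) (ceiln (1 / t) - 1)
    <= lambda R G (ceiln (2 / (1 - t * k%:R))) by rewrite leNgt lam.
have PC K : K \in P -> K \in components G W by move=> /PQ; apply: (subsetP QC).
apply: (lambda_ge_of_rayleigh cardP).
- case/and3P: part => _ tI _; apply: trivIsetS tI.
  by apply/subsetP => K; exact: PC.
- move=> K L KP LP KL x w xK wL; apply: contra KL => xw.
  have wK : w \in K.
    apply: (component_closed (PC _ KP) xK _ xw).
    exact: (subsetP (component_sub (PC _ LP))).
  have tI : trivIset (components G W) by case/and3P: part.
  by rewrite -(def_pblock tI (PC _ KP) wK) (def_pblock tI (PC _ LP) wL).
(* Since [t] is below 1, the truncated subtraction in [ceiln (1 / t) - 1] leaves a positive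
   [eta]. *)
move=> K KP; have c1 : (1 < ceiln (1 / t))%N.
  by rewrite ltnNge ceiln_le ?divr_gt0 // -ltNge.
apply: component_rayleigh.
- rewrite card_gt0; case/and3P: part => _ _ n0.
  by apply: contraNneq n0 => <-; exact: PC.
- by move=> x _; exact: min_deg_le.
(* A positive term makes the cut smaller than [1 / t], and an integer below [1 / t] is at most its
   ceiling minus one. *)
- have [_ le] := PP K KP; move: KP; rewrite inE => /andP[_ pos].
  have : ~~ (ceiln (1 / t) <= ecount G K (~: K))%N.
    rewrite ceiln_le ?divr_gt0 // -ltNge ltr_pdivlMr // mulrC -subr_gt0.
    exact: lt_le_trans le.
  by rewrite -ltnNge; clear; lia.
- have : (ceiln (1 / t) <= min_deg G)%N by rewrite ceiln_le ?divr_gt0.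
  by move: c1; clear; lia.
- by rewrite subn_gt0.
Qed.

Lemma dvdz2_nat (n : nat) : (2 %| n%:Z)%Z = ~~ odd n.
Proof. by rewrite dvdzE -dvdn2. Qed.

Lemma even_of_le h m : (h <= m)%N -> ~~ odd m -> (even_of h <= m)%N.
Proof. by rewrite /even_of; case: ifP; lia. Qed.

Lemma odd_of_le h m : (h <= m)%N -> odd m -> (odd_of h <= m)%N.
Proof. by rewrite /odd_of; case: ifP; lia. Qed.

Theorem theorem1p2 (R : realType) (V : finType) (G : sgraph V) (h : nat)
    (theta : R) (g f : V -> int)
    (hG : edge_connected h G)
    (htheta : 0 < theta < 1)
    (hgf : forall v : V,
        (g v)%:~R <= theta * (deg G v)%:R /\
        theta * (deg G v)%:R <= (f v)%:~R)
    (hpar : forall v : V, (g v = f v %[mod 2])%Z)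
    (hsum : (2 %| \sum_(v : V) f v)%Z) :
  let theta' := Num.min theta (1 - theta) in
  ((* (a) *) spectral_cond G theta' h \/
   (* (b) *) (forall v : V, ~~ odd (deg G v) /\ (2 %| f v)%Z) \/
   (* (c) *) ((forall v : V, ~~ odd (deg G v)) /\
              spectral_cond G theta' (even_of h)) \/
   (* (d) *) ((forall v : V, (2 %| f v)%Z) /\
              spectral_cond G (1 - theta) (odd_of h)) \/
   (* (e) *) ((forall v : V, ((deg G v)%:Z = f v %[mod 2])%Z) /\
              spectral_cond G theta (odd_of h))) ->
  exists H : sgraph V, parity_factor G g f H.
Proof.
move=> theta' cond.
have ok v : gap_even (g v) (f v).
  have [le1 le2] := hgf v; apply/andP; split.
    by rewrite -(ler_int R); apply: le_trans le2.
  by have /eqP := hpar v; rewrite eqz_mod_dvd dvdzE -dvdn2 distnC.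
have [//|[S [T [dis]]]] := parity_factor_or_barrier G ok hsum.
set W := ~: (S :|: T); set Q := [set K in _ | _] => barrier.
case/andP: htheta => th0 th1.
have QC : Q \subset components G W by apply/subsetP => K; rewrite inE => /andP[].
pose eS K := ecount G K S; pose eT K := ecount G K T.
pose term K : R := 1 - theta * (eS K)%:R - (1 - theta) * (eT K)%:R.
have tIQ : trivIset Q.
  by apply: trivIsetS QC _; case/and3P: (components_partition G W).
(* By the bounds on [f] and [g], the barrier sums are at least [theta] times the degrees in [S] and
   [1 - theta] times those in [T]. Both degree sums count e(S,T), whose weights add up to 1. *)
have ge2 : 2 <= \sum_(K in Q) term K.
  have cov : cover Q \subset W.
    by apply/bigcupsP => K /(subsetP QC); exact: component_sub.
  have degsum (A B : {set V}) : [disjoint B & cover Q] ->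
      (ecount G A B + \sum_(K in Q) ecount G K A <= \sum_(x in A) deg G x)%N.
    move=> dB; rewrite sum_deg.
    rewrite (eq_bigr (fun K => ecount G A K)) => [|K _]; last first.
      by rewrite (ecountC _ _ (adj_sym G)).
    by rewrite -ecount_cover // -ecountUr //; apply: ecount_subr; exact: subsetT.
  have dcov (A : {set V}) : A \subset S :|: T -> [disjoint A & cover Q].
    move=> sA; rewrite disjoint_sym disjoints_subset; apply: subset_trans cov _.
    by rewrite setCS.
  have degS := degsum S T (dcov T (subsetUr _ _)).
  have degT : (ecount G S T + \sum_(K in Q) eT K <= \sum_(x in T) deg G x)%N.
    rewrite (ecountC _ _ (adj_sym G)); apply: degsum.
    exact: dcov (subsetUl _ _).
  have fS : theta * (\sum_(x in S) deg G x)%N%:R <= (\sum_(v in S) f v)%:~R.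
    rewrite natr_sum mulr_sumr rmorph_sum /=; apply: ler_sum => v _.
    by case: (hgf v).
  have gT : (1 - theta) * (\sum_(x in T) deg G x)%N%:R
      <= (\sum_(v in T) ((deg G v)%:Z - g v))%:~R.
    rewrite natr_sum mulr_sumr rmorph_sum /=; apply: ler_sum => v _.
    rewrite rmorphB /= mulrBl mul1r lerD2l lerN2; by case: (hgf v).
  move: barrier; rewrite -(ler_int R) !rmorphD /= => barrier.
  move: degS degT; rewrite -!(ler_nat R) !natrD => degS degT.
  have -> : \sum_(K in Q) term K = #|Q|%:R - theta * (\sum_(K in Q) eS K)%N%:R
      - (1 - theta) * (\sum_(K in Q) eT K)%N%:R.
    by rewrite /term !sumrB sumr_const !natr_sum !mulr_sumr.
  have {fS} fS : theta * ((ecount G S T)%:R + (\sum_(K in Q) eS K)%N%:R)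
      <= (\sum_(v in S) f v)%:~R by apply: le_trans fS; rewrite ler_pM2l.
  have {gT} gT : (1 - theta) * ((ecount G S T)%:R + (\sum_(K in Q) eT K)%N%:R)
      <= (\sum_(v in T) ((deg G v)%:Z - g v))%:~R.
    by apply: le_trans gT; rewrite ler_pM2l // subr_gt0.
  rewrite -[(ecount G S T)%:~R]/((ecount G S T)%:R : R) -[#|Q|%:~R]/(#|Q|%:R : R) in barrier.
  by move: barrier fS gT; rewrite !mulrDr; lra.
have cut K : K \in Q -> ecount G K (~: K) = (eS K + eT K)%N.
  by move=> /(subsetP QC); exact: component_cut.
have oddK K : K \in Q -> ~~ (2 %| (eT K)%:Z + \sum_(v in K) f v)%Z.
  by rewrite inE => /andP[].
have cutge K : K \in Q -> (h <= eS K + eT K)%N.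
  move=> KQ; rewrite -cut //.
  have [x xK] : exists x, x \in K.
    apply/set0Pn; have /and3P[_ _ n0] := components_partition G W.
    by apply: contraNneq n0 => <-; exact: (subsetP QC).
  (* If [K] is the whole vertex set, connectivity says nothing; then [T] is empty, and the even sum
     of [f] contradicts the oddness of [K]. *)
  have [/setP KT|[y yK]] := set_0Vmem (~: K); last first.
    by apply: (edge_connected_cut (y := y) hG xK); rewrite -in_setC.
  have KV v : v \in K by have := KT v; rewrite !inE => /negbFE.
  case/negP: (oddK K KQ); have -> : eT K = 0%N.
    apply: ecount0 => u v _ vT; have := subsetP (component_sub (subsetP QC _ KQ)) v (KV v).
    by rewrite !inE vT orbT.
  by rewrite add0r (eq_bigl predT).
have degK K : K \in Q -> ~~ odd (\sum_(v in K) deg G v + (eS K + eT K))%N.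
  move=> KQ; rewrite sum_deg -(setUCr K) ecountUr ?cut //; last first.
    by rewrite disjoints_subset setCK.
  rewrite -addnA addnn oddD odd_double addbF.
  exact: handshake (adj_sym G) (adj_irr G).
have evenf K : (forall v, (2 %| f v)%Z) -> K \in Q -> odd (eT K).
  move=> ev KQ; have := oddK K KQ; rewrite rpredDr ?dvdz2_nat ?negbK //.
  by apply: rpred_sum => v _; exact: ev.
have evend K : (forall v, ~~ odd (deg G v)) -> K \in Q -> ~~ odd (eS K + eT K)%N.
  move=> ev KQ; have := degK K KQ; rewrite oddD.
  suff /negPf -> : ~~ odd (\sum_(v in K) deg G v)%N by [].
  by rewrite -dvdn2; apply: dvdn_sum => v _; rewrite dvdn2 ev.
have term_le0 K : (0 < eS K)%N -> (0 < eT K)%N -> term K <= 0.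
  rewrite -!(ler_nat R) /term => s1 t1; nra.
have min_term K : term K <= 1 - theta' * (eS K + eT K)%:R.
  rewrite /term natrD; have : theta' <= theta by rewrite ge_min lexx.
  have : theta' <= 1 - theta by rewrite ge_min lexx orbT.
  have := ler0n R (eS K); have := ler0n R (eT K); nra.
have th' : 0 < theta' < 1.
  by rewrite lt_min gt_min th1 /= andbT; apply/andP; split=> //; rewrite subr_gt0.
have key t k : 0 < t < 1 -> spectral_cond G t k ->
    {in Q, forall K, term K <= 0 \/
      (k <= eS K + eT K)%N /\ term K <= 1 - t * (eS K + eT K)%:R} -> False.
  move=> t01 sc ht; have := component_terms_lt2 t01 sc QC (term := term).
  have ht' : {in Q, forall K, term K <= 0 \/ (k <= ecount G K (~: K))%N /\
      term K <= 1 - t * (ecount G K (~: K))%:R}.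
    by move=> K KQ; rewrite cut //; exact: ht.
  by move/(_ ht'); rewrite ltNge ge2.
exfalso; case: cond => [ca|[cb|[[cc sc]|[[cd sc]|[ce sc]]]]].
- by apply: (key _ _ th' ca) => K KQ; right; split; [exact: cutge|].
(* In (b) e(K,T) is odd and the cut is even, so e(K,S) is odd as well: every component meets both
   [S] and [T]. *)
- have : \sum_(K in Q) term K <= 0.
    apply: sumr_le0 => K KQ.
    have oT := evenf K (fun v => (cb v).2) KQ.
    have := evend K (fun v => (cb v).1) KQ; rewrite oddD oT => oS.
    by apply: term_le0; [case: (eS K) oS|case: (eT K) oT].
  by move/(le_trans ge2); rewrite lern0.
- apply: (key _ _ th' sc) => K KQ; right; split; last exact: min_term.
  by apply: even_of_le; [exact: cutge|exact: evend].
(* Only components without edges to [S] have positive terms here; their cut is the odd number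
   e(K,T), weighted by [1 - theta]. *)
- have th1' : 0 < 1 - theta < 1 by apply/andP; split; lra.
  apply: (key _ _ th1' sc) => K KQ; have oT := evenf K cd KQ.
  have [e0|s0] := posnP (eS K); last by left; apply: term_le0 => //; case: (eT K) oT.
  right; have := cutge K KQ; rewrite /term e0 add0n mulr0 subr0 => hk.
  by split=> //; exact: odd_of_le.
- have th01 : 0 < theta < 1 by rewrite th0.
  apply: (key _ _ th01 sc) => K KQ.
  (* Modulo 2 the sum of [f] over [K] is the degree sum, that is e(K,S) + e(K,T); adding e(K,T)
     leaves e(K,S), so oddness of [K] is oddness of e(K,S). *)
  have oS : odd (eS K).
    apply: contraNT (oddK K KQ) => eSeven.
    have dd : (2 %| (\sum_(v in K) deg G v)%N%:Z - \sum_(v in K) f v)%Z.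
      rewrite Posz_sum -sumrB; apply: rpred_sum => v _.
      by rewrite -eqz_mod_dvd; apply/eqP.
    have /eqP := degK K KQ; move: eSeven; rewrite -!dvdz2_nat.
    case/dvdzP: dd => q dd /dvdzP[p ep] /eqP/dvdzP[s es]; apply/dvdzP.
    exists (s - p - q).
    move: dd ep es; rewrite !PoszD; move: (\sum_(v in K) f v) (\sum_(v in K) deg G v)%N.
    by move: (eS K) (eT K); clear; lia.
  have [e0|t0] := posnP (eT K); last by left; apply: term_le0 => //; case: (eS K) oS.
  right; have := cutge K KQ; rewrite /term e0 addn0 mulr0 subr0 => hk.
  by split=> //; exact: odd_of_le.
Qed.
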